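(* Let $n\ge3$ and $\mathcal H=L(\mathfrak h)\oplus\mathbb CK$. Let $N$ be an irreducible diagonal $\mathbb Z$-graded $\mathcal H$-module such that $\mathfrak hN=0$ (where $\mathfrak h=\mathfrak h\otimes 1$) and $Kv=av$ for some $a\in\mathbb C$ and all $v\in N$. Then the following hold: \begin{enumerate} \item $\mathcal H_0'$ acts trivially on $N$, and $N$ is an irreducible $\widetilde{\mathcal H}$-module. \item If $v\in N$ is a nonzero homogeneous element, then $v$ is a $\varphi_\mu$-highest vector, where $\varphi_\mu$ is determined by the eigenvalues of the $d^j_{2r+1}$ on $v$, and $N\simeq L_{\varphi_\mu}(\widetilde{\mathcal H},a)$ up to a shift of gradation. In particular, if $a\ne0$, then $N\simeq M_{\varphi_\mu}(\widetilde{\mathcal H},a)$ up to a shift of gradation. \item If $a=0$, then $N$ is the trivial $1$-dimensional module. \item If $a\neq0$, then $M_{\varphi_\mu}(\widetilde{\mathcal H},a)$ has finite-dimensional graded components if and only if $\varphi_\mu$ differs from $\varphi_\nu$ only in finitely many places, where $\nu^j_{2k+1}=0$ for all $k\in\mathbb Z_{\ge0}$, $j=1,\dots,n-1$, or $\nu^j_{2k+1}\ne0$ for all $k\in\mathbb Z_{\ge0}$, $j=1,\dots,n-1$. \end{enumerate}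
   Context: The ground field is $\mathbb C$. Fix $n\ge3$, let $\mathfrak h$ be the space of traceless diagonal $n\times n$ matrices and $L(\mathfrak h)=\mathfrak h\otimes\mathbb C[t,t^{-1}]$, with $h(k)=h\otimes t^k$. $\mathcal H=L(\mathfrak h)\oplus\mathbb CK$ is the Lie superalgebra in which $h(k)$ has the parity of $k$, $K$ is even and central, $[h(k),h'(m)]=0$ if $km$ is even, and $[h(k),h'(m)]=\iota(2hh')(k+m)+2\delta_{-k,m}\operatorname{tr}(hh')K$ if $km$ is odd, where $\iota(z)=z-\frac{\operatorname{tr}z}{n}I_n$. It is $\mathbb Z$-graded by $\deg h(k)=k$, $\deg K=0$. Put $\mathcal H_0'=\bigoplus_{r\in\mathbb Z}\mathfrak h\otimes t^{2r}$, a central ideal, and $\widetilde{\mathcal H}=\mathcal H/\mathcal H_0'$. Every $\widetilde{\mathcal H}$-module is regarded as an $\mathcal H$-module. Fix a basis $h^1,\dots,h^{n-1}$ of $\mathfrak h$ with $\operatorname{tr}(h^ih^j)=\delta_{ij}$, and let $x^j_k$ be the multiple of $h^j\otimes t^k$ by the constant $1/\sqrt2$, so that in $\widetilde{\mathcal H}=\mathbb CK\oplus\bigoplus_{r\in\mathbb Z,\,j}\mathbb Cx^j_{2r+1}$ one has $[x^j_{2r+1},x^i_{2s-1}]=\delta_{ij}\delta_{r,-s}K$. Set $d^j_{2r+1}=x^j_{-2r-1}x^j_{2r+1}$ for $r\in\mathbb Z_{\ge0}$, $1\le j\le n-1$. For $\varphi:\mathbb Z_{\ge0}\to\{\pm\}^{n-1}$,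 $\varphi(m)=(\varphi(m)_1,\dots,\varphi(m)_{n-1})$, let $\widetilde{\mathcal H}^\pm_\varphi$ be the span of all $h^i\otimes t^{2m+1}$ with $\varphi(m)_i=\pm$ and all $h^i\otimes t^{-(2m+1)}$ with $\varphi(m)_i=\mp$ ($m\ge0$, $1\le i\le n-1$), so that $\widetilde{\mathcal H}=\widetilde{\mathcal H}_\varphi^-\oplus\mathbb CK\oplus\widetilde{\mathcal H}_\varphi^+$. The $\varphi$-Verma module $M_\varphi(\widetilde{\mathcal H},a)$ is induced from the $1$-dimensional $(\mathbb CK\oplus\widetilde{\mathcal H}^+_\varphi)$-module on which $K$ acts by $a$ and $\widetilde{\mathcal H}^+_\varphi$ by $0$; it is $\mathbb Z$-graded with generator in degree $0$, and $L_\varphi(\widetilde{\mathcal H},a)$ is its unique irreducible quotient. A $\varphi$-highest vector is a nonzero vector annihilated by $\widetilde{\mathcal H}^+_\varphi$. A $\mathbb Z$-graded module is $N=\bigoplus_iN_i$ with the grading compatible with that of the algebra. A nonzero $\mathbb Z$-graded $\mathcal H$-module is diagonal if all the operators $d^j_{2r+1}$ ($r\ge0$, $1\le j\le n-1$) are simultaneously diagonalizable on it. To a graded component $N_i$ of a diagonal $\mathbb Z$-graded $\mathcal H$-module one associates an $(n-1)$-tuple $\mu=(\mu^1,\dots,\mu^{n-1})$ of infinite sequences $\mu^j=(\mu^j_{2r+1})_{r\ge0}$ consisting of the eigenvalues $\mu^j_{2r+1}\in\{0,a\}$ of $d^j_{2r+1}$. For such a tuple $\mu$ (and likewise $\nu$)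 the map $\varphi_\mu:\mathbb Z_{\ge0}\to\{\pm\}^{n-1}$ is given by $\varphi_\mu(k)_j=+$ if $\mu^j_{2k+1}=0$ and $\varphi_\mu(k)_j=-$ otherwise (that is, if $\mu^j_{2k+1}=a\ne0$). Two maps $\varphi,\psi$ differ only in finitely many places if $\varphi(k)_j\ne\psi(k)_j$ for only finitely many pairs $(k,j)$.
   Formalization: In (2), v is a nonzero homogeneous simultaneous eigenvector of all d^j_{2r+1}; for other homogeneous v (e.g. x^1_{-1}w+x^2_{-1}w, w the generator, φ=+ everywhere, a≠0) no μ is defined and v is not φ-highest for any φ. ''Irreducible'' means no proper nonzero submodule, graded or not. *)

(* Defs.v *)
From HB Require Import structures.
From mathcomp Require Import all_boot all_order all_algebra generic_quotient.
From mathcomp Require Import boolp classical_sets functions cardinality fsbigop.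
From mathcomp Require Import reals complex zify.

Set Implicit Arguments.
Unset Strict Implicit.
Unset Printing Implicit Defensive.

Import GRing.Theory Num.Theory.
Local Open Scope quotient_scope.
Local Open Scope ring_scope.

Section Linear.
Variables (F : fieldType) (V : lmodType F).

Definition subspace (P : V -> Prop) : Prop :=
  P 0 /\ forall (a : F) u v, P u -> P v -> P (a *: u + v).

Definition lspan (S : V -> Prop) (v : V) : Prop :=
  exists s : seq (F * V),
    (forall p, p \in s -> S p.2) /\ v = \sum_(p <- s) p.1 *: p.2.

Lemma subspace_lspan S : subspace (lspan S).
Proof.
split; first by exists [::]; rewrite big_nil.
move=> a u v [s [hs ->]] [t [ht ->]].
exists ([seq (a * p.1, p.2) | p <- s] ++ t); split=> [p|].
  by rewrite mem_cat => /orP[/mapP[q /hs hq ->]|/ht].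
rewrite big_cat big_map scaler_sumr; congr (_ + _).
by apply: eq_bigr => p _; rewrite scalerA.
Qed.

Lemma lspan_incl S v : S v -> lspan S v.
Proof.
move=> Sv; exists [:: (1, v)]; split=> [p|]; first by rewrite inE => /eqP ->.
by rewrite big_seq1 scale1r.
Qed.

Lemma subspaceZ P a u : subspace P -> P u -> P (a *: u).
Proof. by move=> [P0 h] Pu; rewrite -[_ *: _]addr0; apply: h. Qed.

Lemma subspaceD P u v : subspace P -> P u -> P v -> P (u + v).
Proof. by move=> [_ h] Pu Pv; rewrite -[u]scale1r; apply: h. Qed.

Lemma subspaceB P u v : subspace P -> P u -> P v -> P (u - v).
Proof.
by move=> hP Pu Pv; apply: subspaceD => //; rewrite -scaleN1r; apply: subspaceZ.
Qed.

Lemma subspace_sum P (I : eqType) (s : seq I) (c : I -> V) :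
  subspace P -> (forall i, i \in s -> P (c i)) -> P (\sum_(i <- s) c i).
Proof.
move=> hP hc; rewrite big_seq; elim/big_ind: _ => //; first by case: hP.
by move=> u v; apply: subspaceD.
Qed.

Lemma lspan_min S P v : subspace P -> (forall u, S u -> P u) -> lspan S v -> P v.
Proof.
move=> hP SP [s [hs ->]]; apply: subspace_sum => // p /hs /SP.
exact: subspaceZ.
Qed.

End Linear.

Lemma lin0 (F : fieldType) (U V : lmodType F) (f : U -> V) : linear f -> f 0 = 0.
Proof.
by move=> h; have := h (-1) 0 0; rewrite scaler0 addr0 scaleN1r addNr.
Qed.

Lemma linZ (F : fieldType) (U V : lmodType F) (f : U -> V) a u :
  linear f -> f (a *: u) = a *: f u.
Proof. by move=> h; have := h a u 0; rewrite !addr0 lin0 // addr0. Qed.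

Section Heisenberg.
Variables (F : numClosedFieldType) (n : nat).

Definition cartan_pred : {pred 'M[F]_n} :=
  fun A => is_diag_mx A && (\tr A == 0).

Lemma cartan_submod_closed : submod_closed cartan_pred.
Proof.
split=> [|a A B]; first by rewrite /cartan_pred unfold_in mx0_is_diag mxtrace0 eqxx.
rewrite !unfold_in => /andP[/is_diag_mxP dA /eqP tA] /andP[/is_diag_mxP dB /eqP tB].
rewrite linearP /= tA tB mulr0 addr0 eqxx andbT.
by apply/is_diag_mxP => i j ij; rewrite !mxE dA ?dB // mulr0 addr0.
Qed.

HB.instance Definition _ :=
  GRing.isSubmodClosed.Build F 'M[F]_n cartan_pred cartan_submod_closed.

Record cartan := Cartan { cmx :> 'M[F]_n; cartanP : cmx \in cartan_pred }.
HB.instance Definition _ := [isSub for cmx].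
HB.instance Definition _ := [Choice of cartan by <:].
HB.instance Definition _ := [SubChoice_isSubLmodule of cartan by <:].

Definition iota_mx (z : 'M[F]_n) : 'M[F]_n := z - (\tr z / n%:R)%:M.

Lemma cartan_prod_subproof (h h' : cartan) :
  iota_mx (2 *: (cmx h *m cmx h')) \in cartan_pred.
Proof.
have /andP[/diag_mxP[d hd] _] := cartanP h.
have /andP[/diag_mxP[d' hd'] _] := cartanP h'.
rewrite unfold_in hd hd' mulmx_diag; apply/andP; split.
  apply/is_diag_mxP => i j ij; rewrite !mxE.
  by have /negbTE-> : i != j by []; rewrite !mulr0n mulr0 subr0.
rewrite linearB /= mxtrace_scalar.
case: (posnP n) => [n0|n0].
  by rewrite /mxtrace !big1 ?mul0r ?mul0rn ?subr0 // => i; have := ltn_ord i; rewrite {2}n0.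
by rewrite -[X in _ - X]mulr_natr divfK ?subrr // pnatr_eq0 -lt0n.
Qed.

Definition cartan_prod (h h' : cartan) : cartan := Cartan (cartan_prod_subproof h h').

Definition loop_pred : {pred (int -> cartan)} :=
  fun f => `[< finite_set [set k | f k != 0] >].

Lemma loop_submod_closed : submod_closed loop_pred.
Proof.
split=> [|a f g]; rewrite !unfold_in.
  apply/asboolP; apply: (@sub_finite_set _ _ set0) => [k /=|]; last exact: finite_set0.
  by rewrite eqxx.
move=> /asboolP hf /asboolP hg; apply/asboolP.
apply: (@sub_finite_set _ _ ([set k | f k != 0] `|` [set k | g k != 0])%classic).
  move=> k /= h; have [f0|] := eqVneq (f k) 0; last by left.
  by right; apply: contraNneq h => g0; change (a *: f k + g k == 0); rewrite f0 g0 addr0 scaler0.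
by rewrite finite_setU.
Qed.

HB.instance Definition _ :=
  GRing.isSubmodClosed.Build F (int -> cartan) loop_pred loop_submod_closed.

Record loop := Loop { lcoef :> int -> cartan; loopP : lcoef \in loop_pred }.
HB.instance Definition _ := [isSub for lcoef].
HB.instance Definition _ := [Choice of loop by <:].
HB.instance Definition _ := [SubChoice_isSubLmodule of loop by <:].

(* The pair (f, c) stands for sum_k f_k (x) t^k + c K, where f has finite support. *)
Definition heis : Type := (loop * F^o)%type.
HB.instance Definition _ := GRing.Lmodule.on heis.


Lemma loop_finsupp (f : loop) : finite_set [set k | f k != 0].
Proof. by have := loopP f; rewrite unfold_in => /asboolP. Qed.

Lemma cmx_inj : injective cmx. Proof. exact: val_inj. Qed.

Lemma cartan_prod0l h : cartan_prod 0 h = 0.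
Proof.
by apply: cmx_inj; rewrite /= mul0mx scaler0 /iota_mx mxtrace0 mul0r raddf0 subr0.
Qed.

Lemma cartan_prod0r h : cartan_prod h 0 = 0.
Proof.
by apply: cmx_inj; rewrite /= mulmx0 scaler0 /iota_mx mxtrace0 mul0r raddf0 subr0.
Qed.

Lemma cartan_prodZ a b h h' :
  cartan_prod (a *: h) (b *: h') = (a * b) *: cartan_prod h h'.
Proof.
have iotaZ c z : iota_mx (c *: z) = c *: iota_mx z.
  by rewrite /iota_mx mxtraceZ -mulrA -scale_scalar_mx scalerBr.
apply: cmx_inj; rewrite /= -scalemxAl -scalemxAr -iotaZ !scalerA.
by congr (iota_mx (_ *: _)); rewrite -!mulrA mulrC -mulrA.
Qed.

Lemma cartan_prodC h h' : cartan_prod h h' = cartan_prod h' h.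
Proof.
apply: cmx_inj => /=.
have /andP[/diag_mxP[d ->] _] := cartanP h.
have /andP[/diag_mxP[d' ->] _] := cartanP h'.
by rewrite diag_mxC.
Qed.

Definition odd_int (k : int) : bool := odd `|k|%N.

Definition loop_prod_fun (f g : int -> cartan) (p : int) : cartan :=
  \sum_(k \in [set k : int | odd_int k && odd_int (p - k)]) cartan_prod (f k) (g (p - k)).

Lemma loop_prod_subproof (f g : loop) : loop_prod_fun f g \in loop_pred.
Proof.
rewrite unfold_in; apply/asboolP.
apply: (@sub_finite_set _ _ [set x.1 + x.2 |
  x in [set k | f k != 0] `*` [set k | g k != 0]]%classic); last first.
  by apply: finite_image; apply: finite_setX; exact: loop_finsupp.
move=> p /= /eqP hp.
have [k [fk gk]] : exists k, f k != 0 /\ g (p - k) != 0.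
  apply: contrapT => hN; apply: hp; apply: fsbig1 => k _.
  have [->|fk] := eqVneq (f k) 0; first by rewrite cartan_prod0l.
  have [->|gk] := eqVneq (g (p - k)) 0; first by rewrite cartan_prod0r.
  by exfalso; apply: hN; exists k.
by exists (k, p - k) => //=; rewrite addrC subrK.
Qed.

Definition loop_prod (f g : loop) : loop := Loop (loop_prod_subproof f g).

(* The bilinear extension of the bracket: only components of odd degree
   contribute.  [hbr_hloop] gives its values on h (x) t^k and h' (x) t^m.  The
   super-Jacobi identity is immediate, since all double brackets vanish
   ([hbr_nilp]); super-skew-symmetry follows from [hbrC] and [hbr_even]. *)
Definition hbr (x y : heis) : heis :=
  (loop_prod x.1 y.1,
   \sum_(k \in [set k : int | odd_int k]) 2 * \tr (cmx (x.1 k) *m cmx (y.1 (- k)))).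

Lemma fsum_single (V : nmodType) (A : set int) (f : int -> V) (k : int) :
  (forall m, m != k -> f m = 0) ->
  \sum_(m \in A) f m = if `[< A k >] then f k else 0.
Proof.
move=> fk; case: asboolP => [Ak|NAk]; last first.
  by apply: fsbig1 => m Am; apply: fk; apply: contra_notN NAk => /eqP <-.
rewrite -[RHS](@fsbig_set1 _ 0 +%R _ k f) -(@fsbig_widen _ _ _ _ [set k] A) //.
  by move=> m ->.
by move=> m [_ /= /eqP mk]; exact: fk.
Qed.

Lemma loop_single_subproof (h : cartan) (k : int) :
  (fun m => if m == k then h else 0) \in loop_pred.
Proof.
rewrite unfold_in; apply/asboolP; apply: (@sub_finite_set _ _ [set k]) => // m /=.
by case: (m =P k) => // _ /eqP.
Qed.

Definition hloop (h : cartan) (k : int) : heis := (Loop (loop_single_subproof h k), 0).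
Definition hK : heis := (0, 1).

Lemma hbr_hloop h k h' m :
  hbr (hloop h k) (hloop h' m) =
  if odd_int k && odd_int m then
    hloop (cartan_prod h h') (k + m) +
    (if m == - k then 2 * \tr (cmx h *m cmx h') else 0) *: hK
  else 0.
Proof.
have br1 p : loop_prod_fun (hloop h k).1 (hloop h' m).1 p =
    if (odd_int k && odd_int m) && (p == k + m) then cartan_prod h h' else 0.
  rewrite /loop_prod_fun (fsum_single _ (k := k)) /= => [|j /negbTE jk]; last first.
    by rewrite jk cartan_prod0l.
  rewrite eqxx asboolb [p - k == m]subr_eq [m + k]addrC; case: eqVneq => [->|pkm].
    by rewrite addrAC subrr add0r andbT.
  by rewrite cartan_prod0r andbF if_same.
have br2 : (hbr (hloop h k) (hloop h' m)).2 =
    if (odd_int k && odd_int m) && (m == - k) then 2 * \tr (cmx h *m cmx h') else 0.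
  rewrite /= (fsum_single _ (k := k)) => [|j /negbTE jk]; last first.
    by rewrite jk mul0mx mxtrace0 mulr0.
  rewrite eqxx asboolb [- k == m]eq_sym; case: eqVneq => [->|mk].
    by rewrite /odd_int abszN andbb andbT.
  by rewrite mulmx0 mxtrace0 mulr0 andbF if_same.
case: ifPn => okm; apply: injective_projections; rewrite ?br2 ?(negbTE okm) ?okm //=.
- apply: val_inj; apply/funext => p.
  change (loop_prod_fun (hloop h k).1 (hloop h' m).1 p =
    (if p == k + m then cartan_prod h h' else 0) +
    (if m == - k then 2 * \tr (cmx h *m cmx h') else 0) *: 0).
  by rewrite br1 okm scaler0 addr0.
- change ((if m == - k then 2 * \tr (cmx h *m cmx h') else 0) =
    0 + (if m == - k then 2 * \tr (cmx h *m cmx h') else 0) * 1 :> F).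
  by rewrite add0r mulr1.
- by apply: val_inj; apply/funext => p; rewrite /= br1 (negbTE okm).
Qed.


Lemma fsum_lin (V : lmodType F) (A S : set int) (f g : int -> V) (a : F) :
  finite_set S -> (forall m, ~ S m -> f m = 0) -> (forall m, ~ S m -> g m = 0) ->
  \sum_(m \in A) (a *: f m + g m) =
  a *: (\sum_(m \in A) f m) + \sum_(m \in A) g m.
Proof.
move=> finS hf hg.
have wid (u : int -> V) : (forall m, ~ S m -> u m = 0) ->
    \sum_(m \in A) u m = \sum_(m \in (A `&` S)%classic) u m.
  move=> hu; apply/esym/fsbig_widen; first by move=> m [].
  by move=> m [Am NAS]; apply: hu => Sm; apply: NAS.
have fin : finite_set (A `&` S)%classic by exact: finite_setIr.
rewrite (wid f) // (wid g) // wid => [|m NS]; last by rewrite hf // hg // scaler0 addr0.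
by rewrite !fsbig_finite //= big_split scaler_sumr.
Qed.

Lemma cartan_prod_lin h' : linear (cartan_prod^~ h').
Proof.
move=> a x y; apply: cmx_inj => /=.
rewrite mulmxDl scalerDr -scalemxAl scalerA mulrC -scalerA /iota_mx.
rewrite mxtraceD mxtraceZ mulrDl -mulrA raddfD /= -scale_scalar_mx opprD addrACA.
by rewrite -scalerBr.
Qed.

Lemma hbrC x y : hbr x y = hbr y x.
Proof.
apply: injective_projections => /=; last first.
  rewrite [RHS](reindex_fsbig -%R [set k | odd_int k]) /=; last first.
    split=> [k|k m _ _|k ok]; rewrite /odd_int /= ?abszN //; first exact: oppr_inj.
    by exists (- k); rewrite /= ?opprK // abszN.
  by apply: eq_fsbigr => k _; rewrite opprK mxtrace_mulC.
apply: val_inj; apply/funext => p; rewrite /= /loop_prod_fun.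
have K k : p - (p - k) = k by rewrite opprB addrC subrK.
rewrite [RHS](reindex_fsbig (fun k => p - k)
  [set k | odd_int k && odd_int (p - k)]) /=; last first.
  split=> [k /andP[ok opk]|k m _ _|k /andP[ok opk]] /=; first by rewrite K opk ok.
    by move=> /addrI; exact: oppr_inj.
  by exists (p - k); rewrite /= K ?opk.
by apply: eq_fsbigr => k _; rewrite K cartan_prodC.
Qed.

Lemma hbr_linl y : linear (hbr^~ y).
Proof.
move=> a x x'.
have finS := conj (loop_finsupp x.1) (loop_finsupp x'.1).
rewrite -finite_setU in finS.
have out m : ~ ([set k | x.1 k != 0] `|` [set k | x'.1 k != 0])%classic m ->
    x.1 m = 0 /\ x'.1 m = 0.
  move=> N; split; apply: contrapT => /eqP h; apply: N; first by left.
  by right.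
apply: injective_projections; last first.
  rewrite /= -(@fsum_lin F^o _ _ _ _ a finS).
  - apply: eq_fsbigr => k _; rewrite mulmxDl mxtraceD -scalemxAl mxtraceZ mulrDr.
    by rewrite mulrCA.
  - by move=> m /out[-> _]; rewrite mul0mx mxtrace0 mulr0.
  - by move=> m /out[_ ->]; rewrite mul0mx mxtrace0 mulr0.
apply: val_inj; apply/funext => p; change (loop_prod_fun (a *: x + x').1 y.1 p =
  a *: loop_prod_fun x.1 y.1 p + loop_prod_fun x'.1 y.1 p).
rewrite /loop_prod_fun -(fsum_lin _ a finS).
- by apply: eq_fsbigr => k _; rewrite -cartan_prod_lin.
- by move=> m /out[-> _]; rewrite cartan_prod0l.
- by move=> m /out[_ ->]; rewrite cartan_prod0l.
Qed.

Lemma hbr_linr x : linear (hbr x).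
Proof. by move=> a y y'; rewrite !(hbrC x); exact: hbr_linl. Qed.

Definition hparity (b : bool) (x : heis) : Prop :=
  (forall k, x.1 k != 0 -> odd_int k = b) /\ (b -> x.2 = 0).

Definition hdeg (d : int) (x : heis) : Prop :=
  (forall k, x.1 k != 0 -> k = d) /\ (d != 0 -> x.2 = 0).

(* The central ideal spanned by the h (x) t^(2r). *)
Definition heven0 (x : heis) : Prop :=
  (forall k, odd_int k -> x.1 k = 0) /\ x.2 = 0.

Lemma hbr_even (x y : heis) : (forall k, odd_int k -> x.1 k = 0) -> hbr x y = 0.
Proof.
move=> hx; apply: injective_projections => /=.
  apply: val_inj; apply/funext => p; apply: fsbig1 => k /= /andP[ok _].
  by rewrite hx // cartan_prod0l.
by apply: fsbig1 => k /= ok; rewrite hx // mul0mx mxtrace0 mulr0.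
Qed.

Lemma heven0_central (x y : heis) : heven0 x -> hbr x y = 0.
Proof. by case=> hx _; exact: hbr_even. Qed.

Lemma hbr_parity x y : hparity false (hbr x y).
Proof.
split=> // p /eqP hp; apply/negP => op; apply: hp; apply: fsbig1 => k /= /andP[ok].
by move: op ok; rewrite /odd_int => op ok opk; exfalso; lia.
Qed.

Lemma hbr_nilp x y z : hbr (hbr x y) z = 0.
Proof.
apply: hbr_even => k ok; apply: contrapT => /eqP h.
by have [/(_ k h)] := hbr_parity x y; rewrite ok.
Qed.

Lemma heis1D (x y : heis) p : (x + y).1 p = x.1 p + y.1 p.
Proof. by []. Qed.

Lemma heis_decomp (x : heis) : exists s : seq int,
  x = \sum_(k <- s) hloop (x.1 k) k + x.2 *: hK.
Proof.
have [s hs] := (finite_seqP _).1 (loop_finsupp x.1).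
exists (undup s).
have ev (r : seq int) p : (\sum_(k <- r) hloop (x.1 k) k).1 p =
    \sum_(k <- r) (if p == k then x.1 k else 0).
  by elim: r => [|k r IH]; rewrite ?big_nil // !big_cons heis1D IH.
have ev2 (r : seq int) : (\sum_(k <- r) hloop (x.1 k) k).2 = 0.
  elim: r => [|k r IH]; rewrite ?big_nil // !big_cons.
  by change (0 + (\sum_(k <- r) hloop (x.1 k) k).2 = 0); rewrite IH addr0.
apply: injective_projections; last first.
  change (x.2 = (\sum_(k <- undup s) hloop (x.1 k) k).2 + x.2 * 1).
  by rewrite ev2 mulr1 add0r.
apply: val_inj; apply/funext => p.
change (x.1 p = (\sum_(k <- undup s) hloop (x.1 k) k).1 p + x.2 *: 0).
rewrite scaler0 addr0 ev.
have [ps|ps] := boolP (p \in undup s).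
  rewrite (bigD1_seq p) ?undup_uniq //= eqxx big1 ?addr0 // => k /negbTE kp.
  by rewrite eq_sym kp.
rewrite big_seq big1 => [|k ks]; last first.
  by case: eqP => // pk; rewrite pk ks in ps.
apply: contrapT => /eqP xp; have : [set k | x.1 k != 0]%classic p by [].
by rewrite hs /= -mem_undup (negbTE ps).
Qed.

Lemma hdeg_hloop h k : hdeg k (hloop h k).
Proof. by split=> // m /=; case: (m =P k) => // _ /eqP. Qed.

Lemma hdeg_hK c : hdeg 0 (c *: hK).
Proof.
split=> [k|/eqP //].
by change ((c *: (0 : cartan) != 0) -> k = 0); rewrite scaler0 eqxx.
Qed.

Lemma heis_span (x : heis) : lspan (fun y => exists d, hdeg d y) x.
Proof.
have [s ->] := heis_decomp x; set S := fun y : heis => _.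
have hS := subspace_lspan S.
apply: subspaceD => //; last by apply: lspan_incl; exists 0; exact: hdeg_hK.
by apply: subspace_sum => // k _; apply: lspan_incl; exists k; exact: hdeg_hloop.
Qed.

(* The automorphism h (x) t^k |-> c^k h (x) t^k, K |-> K; it is used to show that
   the phi-Verma module and its radical are graded. *)
Section Dilation.
Variable c : F.
Hypothesis c0 : c != 0.

Lemma dilation_subproof (f : loop) : (fun k : int => c ^ k *: f k) \in loop_pred.
Proof.
rewrite unfold_in; apply/asboolP; apply: sub_finite_set (loop_finsupp f) => k /=.
by apply: contraNneq => ->; rewrite scaler0.
Qed.

Definition dilation (x : heis) : heis := (Loop (dilation_subproof x.1), x.2).

Lemma dilation_linear : linear dilation.
Proof.
move=> b x y; apply: injective_projections => //.
apply: val_inj; apply/funext => k.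
change (c ^ k *: (b *: x.1 k + y.1 k) = b *: (c ^ k *: x.1 k) + c ^ k *: y.1 k).
by rewrite scalerDr !scalerA mulrC.
Qed.

Lemma dilation_hdeg d x : hdeg d x -> dilation x = c ^ d *: x.
Proof.
move=> [h1 h2]; apply: injective_projections.
  apply: val_inj; apply/funext => k; change (c ^ k *: x.1 k = c ^ d *: x.1 k).
  by have [->|/h1 ->] := eqVneq (x.1 k) 0; rewrite ?scaler0.
change (x.2 = c ^ d * x.2).
by have [->|/h2 ->] := eqVneq d 0; rewrite ?expr0z ?mul1r ?mulr0.
Qed.

Lemma dilation_hparity b x : hparity b x -> hparity b (dilation x).
Proof.
move=> [h1 h2]; split=> // k hk; apply: h1; apply: contraNneq hk => xk /=.
by rewrite xk scaler0.
Qed.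

Lemma dilation_heven0 x : heven0 x -> heven0 (dilation x).
Proof. by move=> [h1 h2]; split=> // k /h1 /= ->; rewrite scaler0. Qed.

Lemma dilation_hbr x y : dilation (hbr x y) = hbr (dilation x) (dilation y).
Proof.
apply: injective_projections => /=.
  apply: val_inj; apply/funext => p /=; rewrite /loop_prod_fun.
  rewrite -[LHS]addr0 -[X in _ + X](@fsbig1 _ _ (@GRing.add cartan) _
    [set k | odd_int k && odd_int (p - k)] (fun _ => 0)) //.
  rewrite -(fsum_lin _ _ (loop_finsupp x.1)) //.
    apply: eq_fsbigr => k _; rewrite cartan_prodZ -expfzDr // addr0.
    by rewrite [k + (p - k)]addrC subrK.
  by move=> k /= /negP; rewrite negbK => /eqP ->; rewrite cartan_prod0l.
apply: eq_fsbigr => k _; rewrite -scalemxAl -scalemxAr scalerA -expfzDr //.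
by rewrite subrr expr0z scale1r.
Qed.

Lemma dilation_hK : dilation hK = hK.
Proof.
apply: injective_projections => //; apply: val_inj; apply/funext => k.
by change (c ^ k *: (0 : cartan) = 0); rewrite scaler0.
Qed.

End Dilation.

End Heisenberg.

Arguments hK {F n}.

Section Modules.
Variables (F : numClosedFieldType) (n : nat).
Local Notation heis := (heis F n).

Record hmodule := HModule {
  hm_sort :> lmodType F;
  hact : heis -> hm_sort -> hm_sort;
  hact_linl : forall v, linear (hact^~ v);
  hact_linr : forall x, linear (hact x);
  hact_hbr : forall p q x y v, hparity p x -> hparity q y ->
    hact (hbr x y) v = hact x (hact y v) - (-1) ^+ (p && q) *: hact y (hact x v)
}.

Definition submodule (M : hmodule) (P : M -> Prop) : Prop :=
  subspace P /\ forall x v, P v -> P (hact x v).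

(* Simplicity as a plain module: the submodules are not required to be graded. *)
Definition irreducible (M : hmodule) : Prop :=
  (exists v : M, v <> 0) /\
  forall P : M -> Prop, submodule P ->
    (forall v, P v -> v = 0) \/ (forall v, P v).

(* Modules over the quotient of [heis] by the ideal [heven0] are identified with
   the [heis]-modules on which this ideal acts by zero. *)
Definition tilde_module (M : hmodule) : Prop :=
  forall x (v : M), heven0 x -> hact x v = 0.

Definition hmod_hom (M N : hmodule) (f : M -> N) : Prop :=
  linear f /\ forall x v, f (hact x v) = hact x (f v).

Definition direct_sum (V : lmodType F) (G : int -> V -> Prop) : Prop :=
  [/\ forall i, subspace (G i),
      forall v, lspan (fun u => exists i, G i u) v
    & forall (s : seq int) (c : int -> V), uniq s ->
        (forall i, i \in s -> G i (c i)) -> \sum_(i <- s) c i = 0 ->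
        forall i, i \in s -> c i = 0].

(* A Z-graded module carries the parity given by the degree modulo 2, so no
   separate Z/2-grading is recorded. *)
Record gmodule := GModule {
  gm_mod :> hmodule;
  gcomp : int -> gm_mod -> Prop;
  gcomp_direct : direct_sum gcomp;
  gcomp_act : forall d i x v, hdeg d x -> gcomp i v -> gcomp (i + d) (hact x v)
}.

Definition giso_shift (M N : gmodule) : Prop :=
  exists (f : M -> N) (s : int),
    [/\ hmod_hom f, bijective f & forall i v, gcomp i v <-> gcomp (i + s) (f v)].

Definition fin_dim_components (M : gmodule) : Prop :=
  forall i, exists s : seq M, forall v, gcomp i v -> lspan (fun u => u \in s) v.

Definition trivial_1dim (M : hmodule) : Prop :=
  (exists u : M, u <> 0 /\ forall v, exists c : F, v = c *: u) /\
  forall x (v : M), hact x v = 0.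

(* The sum of all proper submodules; when M has a unique maximal submodule, this
   is that submodule. *)
Definition radical (M : hmodule) : M -> Prop :=
  lspan (fun v => exists P, [/\ submodule P, ~ (forall u, P u) & P v]).

Lemma hact0r (M : hmodule) x : hact x 0 = 0 :> M.
Proof.
exact: lin0 (hact_linr x).
Qed.

Lemma radical_submodule M : submodule (@radical M).
Proof.
split; first exact: subspace_lspan.
move=> x v; apply: (@lspan_min _ _ _ (fun v => radical (hact x v))).
  split; first by rewrite hact0r; case: (subspace_lspan (fun v : M =>
    exists P, [/\ submodule P, ~ (forall u, P u) & P v])).
  move=> a u w hu hw; rewrite hact_linr.
  by case: (subspace_lspan (fun v : M =>
    exists P, [/\ submodule P, ~ (forall u, P u) & P v])) => _; apply.
move=> u [P [hP NP Pu]]; apply: lspan_incl; exists P; split=> //.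
by case: hP => _; apply.
Qed.

Section Quotient.
Variables (M : gmodule) (P : M -> Prop).
Hypothesis subP : submodule P.
Hypothesis homP : forall (s : seq int) (c : int -> M), uniq s ->
  (forall i, i \in s -> gcomp i (c i)) -> P (\sum_(i <- s) c i) ->
  forall i, i \in s -> P (c i).

Let linP : subspace P. Proof. by case: subP. Qed.

Definition qrel (u v : M) : bool := `[< P (u - v) >].

Lemma qrel_equiv : equiv_class_of qrel.
Proof.
split=> [u|u v|v u w].
- by apply/asboolP; rewrite subrr; case: linP.
- by apply/asboolP/asboolP => h; rewrite -opprB -scaleN1r; apply: subspaceZ.
- move=> /asboolP h1 /asboolP h2; apply/asboolP.
  by rewrite -(subrK v u) -addrA; apply: subspaceD.
Qed.

Canonical qrel_equivRel := EquivRelPack qrel_equiv.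

Definition quot := {eq_quot qrel}.
HB.instance Definition _ := Choice.on quot.

Definition qpi (v : M) : quot := (\pi_{eq_quot qrel} v)%qT.
Definition qrepr (u : quot) : M := repr u.

Lemma qpiP u v : qpi u = qpi v <-> P (u - v).
Proof.
split=> [/eqmodP/asboolP //|h]; apply/eqmodP; exact/asboolP.
Qed.

Lemma qreprK : cancel qrepr qpi. Proof. exact: reprK. Qed.

Lemma qreprP v : P (qrepr (qpi v) - v).
Proof. by apply/qpiP; rewrite qreprK. Qed.

Definition qadd u v := qpi (qrepr u + qrepr v).
Definition qopp u := qpi (- qrepr u).
Definition qscale (a : F) u := qpi (a *: qrepr u).
Definition qact (x : heis) u := qpi (hact x (qrepr u)).

Lemma qaddE u v : qadd (qpi u) (qpi v) = qpi (u + v).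
Proof. by apply/qpiP; rewrite opprD addrACA; apply: subspaceD => //; exact: qreprP. Qed.

Lemma qscaleE a u : qscale a (qpi u) = qpi (a *: u).
Proof. by apply/qpiP; rewrite -scalerBr; apply: subspaceZ => //; exact: qreprP. Qed.

Lemma qoppE u : qopp (qpi u) = qpi (- u).
Proof.
apply/qpiP; rewrite -opprD -[- (_ + _)]scaleN1r; apply: subspaceZ => //; exact: qreprP.
Qed.

Lemma qactE x u : qact x (qpi u) = qpi (hact x u).
Proof.
apply/qpiP; have := hact_linr x (-1) u (qrepr (qpi u)).
rewrite !scaleN1r ![- _ + _]addrC => <-.
case: subP => _ h; apply: h; exact: qreprP.
Qed.

Lemma qind (Q : quot -> Prop) : (forall v, Q (qpi v)) -> forall u, Q u.
Proof. by move=> h u; rewrite -(qreprK u). Qed.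

Lemma qaddA : associative qadd.
Proof. by elim/qind=> u; elim/qind=> v; elim/qind=> w; rewrite !qaddE addrA. Qed.
Lemma qaddC : commutative qadd.
Proof. by elim/qind=> u; elim/qind=> v; rewrite !qaddE addrC. Qed.
Lemma qadd0 : left_id (qpi 0) qadd.
Proof. by elim/qind=> u; rewrite !qaddE add0r. Qed.
Lemma qaddN : left_inverse (qpi 0) qopp qadd.
Proof. by elim/qind=> u; rewrite qoppE !qaddE addNr. Qed.

HB.instance Definition _ := GRing.isZmodule.Build quot qaddA qaddC qadd0 qaddN.

Lemma qpiD u v : qpi u + qpi v = qpi (u + v).
Proof. exact: qaddE. Qed.

Lemma qscaleA a b u : qscale a (qscale b u) = qscale (a * b) u.
Proof. by elim/qind: u => u; rewrite !qscaleE scalerA. Qed.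
Lemma qscale1 : left_id 1 qscale.
Proof. by elim/qind=> u; rewrite !qscaleE scale1r. Qed.
Lemma qscaleDr : right_distributive qscale +%R.
Proof.
by move=> a; elim/qind=> u; elim/qind=> v; rewrite qpiD !qscaleE qpiD scalerDr.
Qed.
Lemma qscaleDl u : {morph qscale^~ u : a b / a + b}.
Proof. by move=> a b; elim/qind: u => u; rewrite !qscaleE qpiD scalerDl. Qed.

HB.instance Definition _ :=
  GRing.Zmodule_isLmodule.Build F quot qscaleA qscale1 qscaleDr qscaleDl.

Lemma qpi_linear : linear qpi.
Proof. by move=> a u v; rewrite -qpiD -qscaleE. Qed.

Lemma qpiZ a u : a *: qpi u = qpi (a *: u).
Proof. exact: qscaleE. Qed.

Lemma qact_linl u : linear (qact^~ u).
Proof. by move=> a x y; elim/qind: u => u; rewrite !qactE hact_linl qpi_linear. Qed.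

Lemma qact_linr x : linear (qact x).
Proof.
by move=> a; elim/qind=> u; elim/qind=> v; rewrite -qpi_linear !qactE hact_linr qpi_linear.
Qed.

Lemma qact_hbr p q x y u : hparity p x -> hparity q y ->
  qact (hbr x y) u = qact x (qact y u) - (-1) ^+ (p && q) *: qact y (qact x u).
Proof.
move=> hx hy; elim/qind: u => u; rewrite !qactE (hact_hbr _ hx hy).
by rewrite -scaleNr addrC qpi_linear addrC scaleNr.
Qed.

Definition quot_hmodule : hmodule := HModule qact_linl qact_linr qact_hbr.

Definition qcomp (i : int) (u : quot) : Prop := exists2 v, gcomp i v & u = qpi v.

Lemma qcomp_direct : @direct_sum quot qcomp.
Proof.
have [subG spanG _] := gcomp_direct M.
split.
- move=> i; have [G0 GL] := subG i; split; first by exists 0.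
  move=> a _ _ [u Gu ->] [v Gv ->]; exists (a *: u + v); first exact: GL.
  by rewrite qpi_linear.
- elim/qind=> v; have [s [hs ->]] := spanG v.
  exists [seq (p.1, qpi p.2) | p <- s]; split.
    move=> _ /mapP[p /hs [i Gp] ->] /=; by exists i, p.2.
  rewrite big_map /=; elim: s {hs} => [|p s IH]; first by rewrite !big_nil.
  by rewrite !big_cons qpi_linear IH.
- move=> s c us hc c0.
  have [b hb] : exists b : int -> M, forall i, i \in s -> gcomp i (b i) /\ c i = qpi (b i).
    have h i : exists v, i \in s -> gcomp i v /\ c i = qpi v.
      case: (boolP (i \in s)) => [/hc [v Gv ->]|_]; last by exists 0.
      by exists v.
    by have [b hb] := choice h; exists b.
  have Pb : P (\sum_(i <- s) b i).
    rewrite -[X in P X]subr0; apply/qpiP.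
    rewrite -[RHS]c0 big_seq [RHS]big_seq.
    elim/big_rec2: _ => // i u v /hb[_ ->] <-.
    by rewrite qpiD.
  move=> i si; have [_ ->] := hb i si; apply/(qpiP _ 0); rewrite subr0.
  by apply: (homP us _ Pb) => // j /hb[].
Qed.

Lemma qcomp_act d i x u : hdeg d x -> qcomp i u -> qcomp (i + d) (qact x u).
Proof.
move=> hx [v Gv ->]; exists (hact x v); first exact: gcomp_act.
by rewrite qactE.
Qed.

Definition quot_gmodule : gmodule := @GModule quot_hmodule qcomp qcomp_direct qcomp_act.

End Quotient.
End Modules.

Section Phi.
Variables (F : numClosedFieldType) (n : nat).
Local Notation heis := (heis F n).
Variable hb : 'I_n.-1 -> cartan F n.

Definition orthonormal_basis : Prop :=
  (forall h, exists c : 'I_n.-1 -> F, h = \sum_j c j *: hb j) /\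
  forall i j, \tr (cmx (hb i) *m cmx (hb j)) = (i == j)%:R.

Definition xgen (j : 'I_n.-1) (k : int) : heis := (sqrtC 2)^-1 *: hloop (hb j) k.

Definition dop (M : hmodule F n) (j : 'I_n.-1) (r : nat) (v : M) : M :=
  hact (xgen j (- (2 * r + 1)%N%:Z)) (hact (xgen j (2 * r + 1)%N%:Z) v).

(* mu j r is the eigenvalue mu^j_(2r+1). *)
Definition has_eigenvalues (M : hmodule F n) (mu : 'I_n.-1 -> nat -> F) (v : M) : Prop :=
  forall j r, dop j r v = mu j r *: v.

(* Simultaneous diagonalizability: the simultaneous eigenvectors span M. *)
Definition diagonal (M : gmodule F n) : Prop :=
  (exists v : M, v <> 0) /\
  forall v : M, lspan (fun u => exists mu, has_eigenvalues mu u) v.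

(* [true] stands for the sign + and [false] for -. *)
Definition signs := nat -> 'I_n.-1 -> bool.

Definition phi_of (mu : 'I_n.-1 -> nat -> F) : signs := fun k j => mu j k == 0.

Definition finitely_differ (phi psi : signs) : Prop :=
  finite_set [set p : nat * 'I_n.-1 | phi p.1 p.2 != psi p.1 p.2].

Definition hphi (phi : signs) (s : bool) : heis -> Prop :=
  lspan (fun x => exists m i,
    (phi m i = s /\ x = hloop (hb i) (2 * m + 1)%N%:Z) \/
    (phi m i = ~~ s /\ x = hloop (hb i) (- (2 * m + 1)%N%:Z))).

Definition highest_vector (phi : signs) (M : hmodule F n) (v : M) : Prop :=
  v <> 0 /\ forall x, hphi phi true x -> hact x v = 0.

Variables (phi : signs) (a : F).

(* The phi-Verma module U(g) (x)_U(b) F_a, for g = heis / heven0 and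
   b = F K + g^+_phi, is presented as the g-module with one generator VGen and
   the relations K VGen = a VGen and g^+_phi VGen = 0: formal terms modulo the
   smallest congruence containing the module axioms and these relations.  Its
   universal property is [phiVerma_universal] below. *)
Inductive vterm : Type :=
| VGen
| VZero
| VAdd of vterm & vterm
| VScale of F & vterm
| VAct of heis & vterm.

HB.instance Definition _ := gen_eqMixin vterm.
HB.instance Definition _ := gen_choiceMixin vterm.

Record verma_congruence (E : vterm -> vterm -> Prop) : Prop := VermaCongruence {
  vc_refl : forall t, E t t;
  vc_sym : forall t u, E t u -> E u t;
  vc_trans : forall t u w, E t u -> E u w -> E t w;
  vc_add : forall t t' u u', E t t' -> E u u' -> E (VAdd t u) (VAdd t' u');
  vc_scale : forall b t t', E t t' -> E (VScale b t) (VScale b t');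
  vc_act : forall x t t', E t t' -> E (VAct x t) (VAct x t');
  vc_addA : forall t u w, E (VAdd t (VAdd u w)) (VAdd (VAdd t u) w);
  vc_addC : forall t u, E (VAdd t u) (VAdd u t);
  vc_add0 : forall t, E (VAdd VZero t) t;
  vc_addN : forall t, E (VAdd (VScale (-1) t) t) VZero;
  vc_scaleA : forall b c t, E (VScale b (VScale c t)) (VScale (b * c) t);
  vc_scale1 : forall t, E (VScale 1 t) t;
  vc_scaleDr : forall b t u, E (VScale b (VAdd t u)) (VAdd (VScale b t) (VScale b u));
  vc_scaleDl : forall b c t, E (VScale (b + c) t) (VAdd (VScale b t) (VScale c t));
  vc_act_linl : forall b x y t,
    E (VAct (b *: x + y) t) (VAdd (VScale b (VAct x t)) (VAct y t));
  vc_act_linr : forall b x t u,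
    E (VAct x (VAdd (VScale b t) u)) (VAdd (VScale b (VAct x t)) (VAct x u));
  vc_act_hbr : forall p q x y t, hparity p x -> hparity q y ->
    E (VAct (hbr x y) t)
      (VAdd (VAct x (VAct y t)) (VScale (- (-1) ^+ (p && q)) (VAct y (VAct x t))));
  vc_tilde : forall x t, heven0 x -> E (VAct x t) VZero;
  vc_level : E (VAct hK VGen) (VScale a VGen);
  vc_highest : forall x, hphi phi true x -> E (VAct x VGen) VZero
}.

Definition veq (t u : vterm) : Prop := forall E, verma_congruence E -> E t u.

Lemma veq_congruence : verma_congruence veq.
Proof.
split.
- by move=> t E hE; apply: (vc_refl hE).
- by move=> t u h E hE; apply: (vc_sym hE); exact: h.
- by move=> t u w h1 h2 E hE; apply: (vc_trans hE (h1 E hE) (h2 E hE)).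
- by move=> t t' u u' h1 h2 E hE; apply: (vc_add hE); [exact: h1|exact: h2].
- by move=> b t t' h E hE; apply: (vc_scale hE); exact: h.
- by move=> x t t' h E hE; apply: (vc_act hE); exact: h.
- by move=> t u w E hE; apply: (vc_addA hE).
- by move=> t u E hE; apply: (vc_addC hE).
- by move=> t E hE; apply: (vc_add0 hE).
- by move=> t E hE; apply: (vc_addN hE).
- by move=> b c t E hE; apply: (vc_scaleA hE).
- by move=> t E hE; apply: (vc_scale1 hE).
- by move=> b t u E hE; apply: (vc_scaleDr hE).
- by move=> b c t E hE; apply: (vc_scaleDl hE).
- by move=> b x y t E hE; apply: (vc_act_linl hE).
- by move=> b x t u E hE; apply: (vc_act_linr hE).
- by move=> p q x y t hx hy E hE; apply: (vc_act_hbr hE).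
- by move=> x t hx E hE; apply: (vc_tilde hE).
- by move=> E hE; apply: (vc_level hE).
- by move=> x hx E hE; apply: (vc_highest hE).
Qed.

Let vC := veq_congruence.

Definition vrel (t u : vterm) : bool := `[< veq t u >].

Lemma vrel_equiv : equiv_class_of vrel.
Proof.
split=> [t|t u|u t w].
- by apply/asboolP; exact: (vc_refl vC).
- by apply/asboolP/asboolP; exact: (vc_sym vC).
- by move=> /asboolP h1 /asboolP h2; apply/asboolP; exact: (vc_trans vC h1 h2).
Qed.

Canonical vrel_equivRel := EquivRelPack vrel_equiv.

Definition verma : Type := {eq_quot vrel}.
HB.instance Definition _ := Choice.on verma.

Definition vpi (t : vterm) : verma := (\pi_{eq_quot vrel} t)%qT.
Definition vrepr (u : verma) : vterm := repr u.

Lemma vpiP t u : vpi t = vpi u <-> veq t u.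
Proof. by split=> [/eqmodP/asboolP //|h]; apply/eqmodP; exact/asboolP. Qed.

Lemma vreprK : cancel vrepr vpi. Proof. exact: reprK. Qed.

Lemma vreprP t : veq (vrepr (vpi t)) t.
Proof. by apply/vpiP; rewrite vreprK. Qed.

Lemma vind (Q : verma -> Prop) : (forall t, Q (vpi t)) -> forall u, Q u.
Proof. by move=> h u; rewrite -(vreprK u). Qed.

Definition vadd u v := vpi (VAdd (vrepr u) (vrepr v)).
Definition vscale b u := vpi (VScale b (vrepr u)).
Definition vopp u := vscale (-1) u.
Definition vact x u := vpi (VAct x (vrepr u)).

Lemma vaddE t u : vadd (vpi t) (vpi u) = vpi (VAdd t u).
Proof. by apply/vpiP; apply: (vc_add vC); exact: vreprP. Qed.
Lemma vscaleE b t : vscale b (vpi t) = vpi (VScale b t).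
Proof. by apply/vpiP; apply: (vc_scale vC); exact: vreprP. Qed.
Lemma vactE x t : vact x (vpi t) = vpi (VAct x t).
Proof. by apply/vpiP; apply: (vc_act vC); exact: vreprP. Qed.

Lemma vaddA : associative vadd.
Proof.
by elim/vind=> t; elim/vind=> u; elim/vind=> w; rewrite !vaddE; apply/vpiP; exact: (vc_addA vC).
Qed.
Lemma vaddC : commutative vadd.
Proof. by elim/vind=> t; elim/vind=> u; rewrite !vaddE; apply/vpiP; exact: (vc_addC vC). Qed.
Lemma vadd0 : left_id (vpi VZero) vadd.
Proof. by elim/vind=> t; rewrite !vaddE; apply/vpiP; exact: (vc_add0 vC). Qed.
Lemma vaddN : left_inverse (vpi VZero) vopp vadd.
Proof. by elim/vind=> t; rewrite /vopp vscaleE vaddE; apply/vpiP; exact: (vc_addN vC). Qed.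

HB.instance Definition _ := GRing.isZmodule.Build verma vaddA vaddC vadd0 vaddN.

Lemma vpiD t u : vpi (VAdd t u) = vpi t + vpi u.
Proof. by rewrite -vaddE. Qed.

Lemma vscaleA b c u : vscale b (vscale c u) = vscale (b * c) u.
Proof. by elim/vind: u => t; rewrite !vscaleE; apply/vpiP; exact: (vc_scaleA vC). Qed.
Lemma vscale1 : left_id 1 vscale.
Proof. by elim/vind=> t; rewrite vscaleE; apply/vpiP; exact: (vc_scale1 vC). Qed.
Lemma vscaleDr : right_distributive vscale +%R.
Proof.
move=> b; elim/vind=> t; elim/vind=> u; rewrite -vpiD !vscaleE -vpiD.
by apply/vpiP; exact: (vc_scaleDr vC).
Qed.
Lemma vscaleDl u : {morph vscale^~ u : b c / b + c}.
Proof.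
by move=> b c; elim/vind: u => t; rewrite !vscaleE -vpiD; apply/vpiP; exact: (vc_scaleDl vC).
Qed.

HB.instance Definition _ :=
  GRing.Zmodule_isLmodule.Build F verma vscaleA vscale1 vscaleDr vscaleDl.

Lemma vpiZ b t : vpi (VScale b t) = b *: vpi t.
Proof. exact: (esym (vscaleE b t)). Qed.

Lemma vpi0 : vpi VZero = 0. Proof. by []. Qed.

Lemma vact_linl u : linear (vact^~ u).
Proof.
move=> b x y; elim/vind: u => t; rewrite !vactE -vpiZ -vpiD.
by apply/vpiP; exact: (vc_act_linl vC).
Qed.

Lemma vact_linr x : linear (vact x).
Proof.
move=> b; elim/vind=> t; elim/vind=> u; rewrite -vpiZ -vpiD !vactE -vpiZ -vpiD.
by apply/vpiP; exact: (vc_act_linr vC).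
Qed.

Lemma vact_hbr p q x y u : hparity p x -> hparity q y ->
  vact (hbr x y) u = vact x (vact y u) - (-1) ^+ (p && q) *: vact y (vact x u).
Proof.
move=> hx hy; elim/vind: u => t; rewrite !vactE -scaleNr -vpiZ -vpiD.
by apply/vpiP; exact: (vc_act_hbr vC).
Qed.

Definition verma_hmodule : hmodule F n := HModule vact_linl vact_linr vact_hbr.

Inductive vdeg : int -> vterm -> Prop :=
| vdeg_gen : vdeg 0 VGen
| vdeg_zero i : vdeg i VZero
| vdeg_add i t u : vdeg i t -> vdeg i u -> vdeg i (VAdd t u)
| vdeg_scale i b t : vdeg i t -> vdeg i (VScale b t)
| vdeg_act i d x t : hdeg d x -> vdeg i t -> vdeg (i + d) (VAct x t).

Definition vcomp (i : int) (u : verma) : Prop := exists2 t, vdeg i t & u = vpi t.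

Lemma vcomp_sub i : subspace (vcomp i).
Proof.
split; first by exists VZero; [exact: vdeg_zero|].
move=> b _ _ [t ht ->] [u hu ->]; exists (VAdd (VScale b t) u).
  by apply: vdeg_add => //; apply: vdeg_scale.
by rewrite vpiD vpiZ.
Qed.

Lemma vcomp_act d i x u : hdeg d x -> vcomp i u -> vcomp (i + d) (vact x u).
Proof.
by move=> hx [t ht ->]; exists (VAct x t); [exact: vdeg_act|rewrite vactE].
Qed.

Lemma vcomp_span u : lspan (fun w => exists i, vcomp i w) u.
Proof.
set G := fun w : verma => exists i, vcomp i w.
have hG : subspace (lspan G) by exact: subspace_lspan.
elim/vind: u; elim=> [||t IHt u IHu|b t IH|x t IH].
- by apply: lspan_incl; exists 0; exists VGen => //; exact: vdeg_gen.
- by rewrite vpi0; case: hG.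
- by rewrite vpiD; exact: subspaceD.
- by rewrite vpiZ; exact: subspaceZ.
rewrite -vactE; move: (heis_span x); apply: (@lspan_min _ _ _ (fun x => lspan G (vact x (vpi t)))).
  split; first by rewrite (lin0 (vact_linl (vpi t))); case: hG.
  by move=> b y z hy hz; rewrite vact_linl; case: hG => _; apply.
move=> y [d hy]; move: IH; apply: (@lspan_min _ _ _ (fun v => lspan G (vact y v))).
  split; first by have := @hact0r _ _ verma_hmodule y => /= ->; case: hG.
  by move=> b v w hv hw; rewrite vact_linr; case: hG => _; apply.
by move=> v [i hv]; apply: lspan_incl; exists (i + d); exact: vcomp_act.
Qed.

Section Theta.
Variable c : F.
Hypothesis c0 : c != 0.

Lemma dilation_hphi x : hphi phi true x -> hphi phi true (dilation c x).
Proof.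
apply: (@lspan_min _ _ _ (fun x => hphi phi true (dilation c x))).
  have [h0 hL] : subspace (hphi phi true) by exact: subspace_lspan.
  split; last by move=> b y z hy hz; rewrite dilation_linear; apply: hL.
  by rewrite (lin0 (dilation_linear c)).
move=> y [m [i h]].
have [k hk] : exists k, hdeg k y by case: h => -[_ ->]; eexists; exact: hdeg_hloop.
rewrite (dilation_hdeg _ hk); apply: subspaceZ; first exact: subspace_lspan.
by apply: lspan_incl; exists m, i.
Qed.

Fixpoint theta_term (t : vterm) : vterm :=
  match t with
  | VGen => VGen
  | VZero => VZero
  | VAdd t u => VAdd (theta_term t) (theta_term u)
  | VScale b t => VScale b (theta_term t)
  | VAct x t => VAct (dilation c x) (theta_term t)
  end.

Lemma theta_congruence E : verma_congruence E ->
  verma_congruence (fun t u => E (theta_term t) (theta_term u)).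
Proof.
move=> hE; split=> /=.
- by move=> t; apply: (vc_refl hE).
- by move=> t u; apply: (vc_sym hE).
- by move=> t u w; apply: (vc_trans hE).
- by move=> t t' u u'; apply: (vc_add hE).
- by move=> b t t'; apply: (vc_scale hE).
- by move=> x t t'; apply: (vc_act hE).
- by move=> t u w; apply: (vc_addA hE).
- by move=> t u; apply: (vc_addC hE).
- by move=> t; apply: (vc_add0 hE).
- by move=> t; apply: (vc_addN hE).
- by move=> b b' t; apply: (vc_scaleA hE).
- by move=> t; apply: (vc_scale1 hE).
- by move=> b t u; apply: (vc_scaleDr hE).
- by move=> b b' t; apply: (vc_scaleDl hE).
- by move=> b x y t; rewrite dilation_linear; apply: (vc_act_linl hE).
- by move=> b x t u; apply: (vc_act_linr hE).
- move=> p q x y t hx hy; rewrite dilation_hbr //.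
  by apply: (vc_act_hbr hE); exact: dilation_hparity.
- by move=> x t hx; apply: (vc_tilde hE); exact: dilation_heven0.
- by rewrite dilation_hK; apply: (vc_level hE).
- by move=> x hx; apply: (vc_highest hE); exact: dilation_hphi.
Qed.

Definition theta (u : verma) : verma := vpi (theta_term (vrepr u)).

Lemma thetaE t : theta (vpi t) = vpi (theta_term t).
Proof.
apply/vpiP => E hE; exact: (vreprP t (theta_congruence hE)).
Qed.

Lemma theta_linear : linear theta.
Proof.
move=> b; elim/vind=> t; elim/vind=> u.
by rewrite -vpiZ -vpiD !thetaE /= vpiD vpiZ.
Qed.

Lemma theta_act x u : theta (vact x u) = vact (dilation c x) (theta u).
Proof. by elim/vind: u => t; rewrite vactE !thetaE vactE. Qed.

Lemma theta_comp i u : vcomp i u -> theta u = c ^ i *: u.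
Proof.
move=> [t ht ->]; rewrite thetaE; elim: ht => {i t u}.
- by rewrite expr0z scale1r.
- by move=> i /=; rewrite vpi0 scaler0.
- by move=> i t u _ IHt _ IHu /=; rewrite !vpiD IHt IHu scalerDr.
- by move=> i b t _ IH /=; rewrite !vpiZ IH !scalerA mulrC.
- move=> i d x t hx _ IH /=; rewrite -!vactE IH (dilation_hdeg _ hx).
  rewrite (linZ _ _ (vact_linl _)) (linZ _ _ (vact_linr _)) scalerA.
  by rewrite expfzDr // mulrC.
Qed.

End Theta.

Lemma theta_inv c u : c != 0 -> theta c^-1 (theta c u) = u.
Proof.
move=> c0; have c0' : c^-1 != 0 by rewrite invr_eq0.
have h : subspace (fun u => theta c^-1 (theta c u) = u).
  split; last by move=> b v w hv hw; rewrite !theta_linear // hv hw.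
  by rewrite (lin0 (theta_linear c0)) (lin0 (theta_linear c0')).
apply: (lspan_min h) (vcomp_span u) => v [i vi].
rewrite (theta_comp c0 vi) (linZ _ _ (theta_linear c0')) (theta_comp c0' vi) scalerA exprz_inv.
by rewrite -expfzDr // subrr expr0z scale1r.
Qed.

Lemma theta_stable_homogeneous (P : verma -> Prop) : subspace P ->
  (forall u, P u -> P (theta 2 u)) ->
  forall (s : seq int) (b : int -> verma), uniq s ->
  (forall i, i \in s -> vcomp i (b i)) -> P (\sum_(i <- s) b i) ->
  forall i, i \in s -> P (b i).
Proof.
move=> hP hT; have two0 : (2 : F) != 0 by rewrite pnatr_eq0.
elim=> [//|j s IH] b /=/andP[js us] hc Pb.
have hc' i : i \in s -> vcomp i (b i) by move=> si; apply: hc; rewrite inE si orbT.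
have T0 : theta 2 0 = 0 by exact: lin0 (theta_linear two0).
have TD u v : theta 2 (u + v) = theta 2 u + theta 2 v.
  by have := theta_linear two0 1 u v; rewrite !scale1r.
have TS (r : seq int) : (forall i, i \in r -> vcomp i (b i)) ->
    theta 2 (\sum_(i <- r) b i) = \sum_(i <- r) 2 ^ i *: b i.
  move=> hr; rewrite (big_morph _ TD T0) big_seq [RHS]big_seq.
  by apply: eq_bigr => i ri; rewrite (theta_comp two0 (hr i ri)).
have Ps i : i \in s -> P (b i).
  move=> si.
  have hsc k : k \in s -> vcomp k ((2 ^ k - 2 ^ j) *: b k).
    by move=> sk; apply: subspaceZ; [exact: vcomp_sub|exact: hc'].
  have : P (\sum_(k <- s) (2 ^ k - 2 ^ j) *: b k).
    have -> : \sum_(k <- s) (2 ^ k - 2 ^ j) *: b k =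
        theta 2 (\sum_(k <- j :: s) b k) - 2 ^ j *: \sum_(k <- j :: s) b k.
      rewrite TS // scaler_sumr -sumrB big_cons subrr add0r.
      by apply: eq_bigr => k _; rewrite scalerBl.
    apply: subspaceB => //; first exact: hT.
    exact: subspaceZ.
  move=> /(IH _ us hsc) /(_ i si) Pi.
  have ij : 2 ^ i - 2 ^ j != 0 :> F.
    rewrite subr_eq0; apply: contraNneq js => e.
    have e1 : (2 : F) ^ (i - j) = 1.
      by rewrite expfzDr // e -expfzDr // subrr expr0z.
    suff /eqP : i - j = 0 by rewrite subr_eq0 => /eqP <-; exact: si.
    have pow m : (2 : F) ^+ m == 1 -> m = 0%N.
      by rewrite -natrX pnatr_eq1 -(expn0 2) eqn_exp2l // => /eqP.
    case: (i - j) e1 => m; first by move/eqP/pow => ->.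
    by rewrite -[X in X = 1]/((2 ^+ m.+1)^-1) => /eqP; rewrite invr_eq1 => /pow.
  rewrite -[b i]scale1r -(mulVf ij) -scalerA.
  exact: subspaceZ.
move=> i; rewrite inE => /orP[/eqP->|]; last exact: Ps.
have -> : b j = \sum_(k <- j :: s) b k - \sum_(k <- s) b k.
  by rewrite big_cons addrK.
by apply: subspaceB => //; apply: subspace_sum.
Qed.

Lemma vcomp_direct : direct_sum vcomp.
Proof.
split; [exact: vcomp_sub|exact: vcomp_span|].
have P0 : subspace (fun u : verma => u = 0).
  by split=> // b u v -> ->; rewrite scaler0 addr0.
apply: (theta_stable_homogeneous P0) => u ->.
have two0 : (2 : F) != 0 by rewrite pnatr_eq0.
exact: lin0 (theta_linear two0).
Qed.

Definition phiVerma : gmodule F n :=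
  @GModule F n verma_hmodule vcomp vcomp_direct vcomp_act.

Definition verma_gen : phiVerma := vpi VGen.

Lemma verma_gen_spec :
  [/\ gcomp 0 verma_gen, hact hK verma_gen = a *: verma_gen,
      forall x, hphi phi true x -> hact x verma_gen = 0
    & tilde_module phiVerma].
Proof.
split.
- by exists VGen => //; exact: vdeg_gen.
- by rewrite /= vactE -vpiZ; apply/vpiP; exact: (vc_level vC).
- by move=> x hx; rewrite /= vactE -vpi0; apply/vpiP; exact: (vc_highest vC).
- by move=> x; elim/vind=> t hx; rewrite /= vactE -vpi0; apply/vpiP; exact: (vc_tilde vC).
Qed.

Lemma phiVerma_universal (W : hmodule F n) (w : W) : tilde_module W ->
  hact hK w = a *: w -> (forall x, hphi phi true x -> hact x w = 0) ->
  exists2 f : phiVerma -> W, hmod_hom f /\ f verma_gen = w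
    & forall g : phiVerma -> W, hmod_hom g -> g verma_gen = w -> g =1 f.
Proof.
move=> hW hKw hw.
pose ev := fix ev (t : vterm) : W := match t with
  | VGen => w | VZero => 0 | VAdd t u => ev t + ev u
  | VScale b t => b *: ev t | VAct x t => hact x (ev t) end.
have hev : verma_congruence (fun t u => ev t = ev u).
  split=> //=.
  - by move=> t u w' -> ->.
  - by move=> t t' u u' -> ->.
  - by move=> b t t' ->.
  - by move=> x t t' ->.
  - by move=> t u w'; rewrite addrA.
  - by move=> t u; rewrite addrC.
  - by move=> t; rewrite add0r.
  - by move=> t; rewrite scaleN1r addNr.
  - by move=> b c t; rewrite scalerA.
  - by move=> t; rewrite scale1r.
  - by move=> b t u; rewrite scalerDr.
  - by move=> b c t; rewrite scalerDl.
  - by move=> b x y t; rewrite hact_linl.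
  - by move=> b x t u; rewrite hact_linr.
  - by move=> p q x y t hx hy; rewrite (hact_hbr _ hx hy) scaleNr.
  - by move=> x t hx; exact: hW.
pose f (u : phiVerma) : W := ev (vrepr u).
have fE t : f (vpi t) = ev t by exact: (vreprP t hev).
exists f; first split=> //.
- split; last by move=> x; elim/vind=> t; rewrite /= vactE !fE.
  by move=> b; elim/vind=> t; elim/vind=> u; rewrite -vpiZ -vpiD !fE.
- by rewrite fE.
move=> g [glin gact] gw; elim/vind=> t; rewrite fE; elim: t => /=.
- exact: gw.
- by rewrite vpi0; exact: lin0 glin.
- by move=> t <- u <-; rewrite vpiD; have := glin 1 (vpi t) (vpi u); rewrite !scale1r.
- by move=> b t <-; rewrite vpiZ; exact: linZ glin.
- by move=> x t <-; rewrite -gact /= vactE.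
Qed.

Lemma radical_homogeneous (s : seq int) (b : int -> phiVerma) : uniq s ->
  (forall i, i \in s -> gcomp i (b i)) -> radical (\sum_(i <- s) b i) ->
  forall i, i \in s -> radical (b i).
Proof.
apply: theta_stable_homogeneous; first exact: subspace_lspan.
have two0 : (2 : F) != 0 by rewrite pnatr_eq0.
have two0' : (2 : F)^-1 != 0 by rewrite invr_eq0.
have hR : subspace (@radical F n phiVerma) by exact: subspace_lspan.
move=> u; apply: (@lspan_min _ _ _ (fun u => radical (theta 2 u : phiVerma))).
  split; last by move=> a' v w hv hw; rewrite theta_linear //; case: hR => _; apply.
  by rewrite (lin0 (theta_linear two0)); case: hR.
move=> v [P [[[P0 PL] Pact] NP Pv]]; apply: lspan_incl.
exists (fun w => P (theta 2^-1 w)); split; last by rewrite theta_inv.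
  split; last by move=> x w hw; rewrite /= theta_act //; exact: Pact.
  split; last by move=> a' w z hw hz; rewrite theta_linear //; exact: PL.
  by rewrite /= (lin0 (theta_linear two0')).
move=> h; apply: NP => w; have := h (theta 2 w).
by rewrite theta_inv.
Qed.

(* The irreducible quotient of the phi-Verma module. *)
Definition phiIrr : gmodule F n :=
  quot_gmodule (radical_submodule phiVerma) radical_homogeneous.

End Phi.

Section Tuples.
Variables (F : numClosedFieldType) (n : nat).

(* The tuples attached to graded components of M. *)
Definition component_tuple (hb : 'I_n.-1 -> cartan F n) (M : gmodule F n)
    (mu : 'I_n.-1 -> nat -> F) : Prop :=
  exists i (v : M), [/\ v <> 0, gcomp i v & has_eigenvalues hb mu v].

Definition constant_tuple (a : F) (nu : 'I_n.-1 -> nat -> F) : Prop :=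
  (forall j k, nu j k = 0 \/ nu j k = a) /\
  ((forall j k, nu j k = 0) \/ (forall j k, nu j k <> 0)).

End Tuples.

(* Main.v *)
(* On [heis] modulo [heven0] the x^j_k with k odd generate a Clifford algebra:
   they anticommute and square to zero, except that x^j_k and x^j_(-k) have
   anticommutator K = a.  The even part [heven0] dies because a bijective central
   operator z of nonzero degree would give the proper nonzero submodule
   (1 - z) N.  If a != 0, an eigenvector of all the x_(-k) x_k is killed by one
   of x_k and x_(-k) for every k, which makes N a quotient of the phi-Verma
   module; the latter is a fermionic Fock space, simple because the annihilation
   operators strip off the creation operators of a vector one at a time.  If
   a = 0, every x_k has a proper submodule as image, so it acts by zero.  Finally
   the degrees of the creation operators are +-(2m + 1) according to the signs
   phi(m)_j: infinitely many sign changes produce infinitely many independent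
   vectors of degree 0 or +-2, while finitely many leave only finitely many
   monomials in each degree. *)

From mathcomp Require Import boolp classical_sets cardinality zify.
Require Import Defs.
From mathcomp Require Import all_boot all_order all_algebra.
From mathcomp Require Import reals complex.

Set Implicit Arguments.
Unset Strict Implicit.
Unset Printing Implicit Defensive.

Import Order.TTheory GRing.Theory Num.Theory.
Local Open Scope ring_scope.

(** * Linear maps and formal Fock spaces *)

Section LinearFunctions.
Variables (F : fieldType) (U V : lmodType F) (f : U -> V).
Hypothesis flin : linear f.

Lemma linD u v : f (u + v) = f u + f v.
Proof. by have := flin 1 u v; rewrite !scale1r. Qed.

Lemma linN u : f (- u) = - f u.
Proof. by rewrite -scaleN1r linZ // scaleN1r. Qed.

Lemma linB u v : f (u - v) = f u - f v.
Proof. by rewrite linD linN. Qed.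

Lemma lin_sum (I : Type) (s : seq I) (c : I -> U) :
  f (\sum_(i <- s) c i) = \sum_(i <- s) f (c i).
Proof. exact: (big_morph f linD (lin0 flin)). Qed.

Lemma subspace_preim (P : V -> Prop) : subspace P -> subspace (fun u => P (f u)).
Proof.
move=> [P0 PL]; split=> [|c u v Pu Pv]; first by rewrite lin0.
by rewrite flin; exact: PL.
Qed.

End LinearFunctions.

Lemma subspace_eq0 (F : fieldType) (V : lmodType F) : subspace (fun v : V => v = 0).
Proof. by split=> // c u v -> ->; rewrite scaler0 addr0. Qed.

Section Fock.
Variables (F : fieldType) (V : lmodType F) (I : eqType).
Variables (y ys : I -> V -> V) (g : V) (a : F).
Hypothesis ylin : forall i, linear (y i).
Hypothesis yslin : forall i, linear (ys i).
Hypothesis yanti : forall i j u, y i (y j u) = - y j (y i u).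
Hypothesis ysq : forall i u, y i (y i u) = 0.
Hypothesis ysy : forall i j u,
  ys i (y j u) = (if i == j then a *: u else 0) - y j (ys i u).
Hypothesis ysg : forall i, ys i g = 0.

(* The degree-d part of the span of the monomials y_i1 ... y_ir g with all
   indices in L, where y_i has degree dg i. *)
Inductive fock (dg : I -> int) (L : seq I) : int -> V -> Prop :=
| fock_gen : fock dg L 0 g
| fock0 d : fock dg L d 0
| fock_lin d c u v : fock dg L d u -> fock dg L d v -> fock dg L d (c *: u + v)
| fock_act d e i u : i \in L -> e = d + dg i -> fock dg L d u -> fock dg L e (y i u).

Lemma fock_sub dg L d : subspace (fock dg L d).
Proof. by split=> [|c u v]; [exact: fock0|exact: fock_lin]. Qed.

Lemma fock_subset dg L L' d u :
  {subset L <= L'} -> fock dg L d u -> fock dg L' d u.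
Proof.
move=> sL; elim=> {d u} [|d|d c u v _ ? _ ?|d e i u iL -> _ ?].
- exact: fock_gen.
- exact: fock0.
- exact: fock_lin.
- exact: (fock_act (sL _ iL)).
Qed.

(** Used with k = 0 to forget the grading, and with k = 1 or -1 to make all but finitely many
    creation degrees negative. *)
Lemma fock_regrade (k : int) dg L d u :
  fock dg L d u -> fock (fun i => k * dg i) L (k * d) u.
Proof.
elim=> {d u} [|d|d c u v _ ? _ ?|d e i u iL -> _ ?].
- by rewrite mulr0; exact: fock_gen.
- exact: fock0.
- exact: fock_lin.
- by apply: (fock_act iL); first exact: mulrDr.
Qed.

(** [ys i] moves to the right past the [y j], changing signs, until it kills [g]; the other terms
    lose one factor [y i], hence [dg i] in degree. *)
Lemma fock_ann dg L d u i : fock dg L d u -> fock dg L (d - dg i) (ys i u).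
Proof.
elim=> {d u} [|d|d c u v _ ? _ ?|d e j u jL -> fu IH].
- by rewrite ysg; exact: fock0.
- by rewrite (lin0 (yslin _)); exact: fock0.
- by rewrite yslin; exact: fock_lin.
rewrite ysy; apply: subspaceB; first exact: fock_sub.
  case: eqP => [->|_]; last exact: fock0.
  by rewrite addrK; apply: subspaceZ => //; exact: fock_sub.
by apply: (fock_act jL) IH; rewrite addrAC.
Qed.

Lemma fock_ann_notin dg L d u i : i \notin L -> fock dg L d u -> ys i u = 0.
Proof.
move=> iL; elim=> {d u} [//|d|d c u v _ IHu _ IHv|d e j u jL _ _ IH].
- exact: lin0.
- by rewrite yslin IHu IHv scaler0 addr0.
- rewrite ysy IH (lin0 (ylin _)) subr0; case: eqP => // ij.
  by rewrite ij jL in iL.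
Qed.

Lemma fock_nil dg d u :
  fock dg [::] d u -> (exists c, u = c *: g) /\ (d != 0 -> u = 0).
Proof.
elim=> {d u} [|d|d c u v _ [[b ->] IHu] _ [[b' ->] IHv]|//].
- by split; first by exists 1; rewrite scale1r.
- by split; first by exists 0; rewrite scale0r.
- split=> [|d0]; first by exists (c * b + b'); rewrite scalerA -scalerDl.
  by rewrite IHu // IHv // scaler0 addr0.
Qed.

(** Anticommuting [y l] to the front costs only signs, and [y l] squares to zero, so a monomial
    contains it at most once. *)
Lemma fock_cons dg l L d u : fock dg (l :: L) d u ->
  exists u0 w, [/\ fock dg L d u0, fock dg L (d - dg l) w & u = u0 + y l w].
Proof.
elim=> {d u} [|d|d c _ _ _ [u [w [hu hw ->]]] _ [u' [w' [hu' hw' ->]]]|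
  d e i _ iL -> _ [u [w [hu hw ->]]]].
- by exists g, 0; split; [exact: fock_gen|exact: fock0|rewrite (lin0 (ylin _)) addr0].
- by exists 0, 0; split; [exact: fock0|exact: fock0|rewrite (lin0 (ylin _)) addr0].
- exists (c *: u + u'), (c *: w + w'); split; try exact: fock_lin.
  by rewrite ylin scalerDr addrACA.
have [->|il] := eqVneq i l.
  exists 0, u; split; [exact: fock0|by rewrite addrK|].
  by rewrite linD // ysq addr0 add0r.
have {}iL : i \in L by move: iL; rewrite inE (negbTE il).
exists (y i u), (- y i w); split; first exact: (fock_act iL).
  rewrite -scaleN1r; apply: subspaceZ; first exact: fock_sub.
  by apply: (fock_act iL) hw; rewrite addrAC.
by rewrite linD // linN // (yanti i l w).
Qed.

(* If l does not occur in L and u = u0 + y_l w with u0, w built from L, then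
   ys_l u = a w: either w is a shorter nonzero vector, or u = u0. *)
Lemma fock_reduce (P : V -> Prop) dg L d u : a != 0 -> subspace P ->
  (forall i v, P v -> P (ys i v)) -> fock dg L d u -> u <> 0 -> P u -> P g.
Proof.
move=> a0 hP Pys; elim: L d u => [|l L IH] d u hu u0 Pu.
  have [[c uE] _] := fock_nil hu; have c0 : c != 0.
    by apply/eqP => c0; apply: u0; rewrite uE c0 scale0r.
  by rewrite -[g]scale1r -(mulVf c0) -scalerA -uE; exact: subspaceZ.
(* A repeated index allows no new monomials and is dropped, so that [ys l] kills what is built from
   L. *)
have [lL|lL] := boolP (l \in L).
  apply: IH u0 Pu; apply: fock_subset hu => i.
  by rewrite inE => /orP[/eqP->|].
have [u1 [w [hu1 hw uE]]] := fock_cons hu.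
have [w0|/eqP w0] := eqVneq w 0.
  by apply: IH u0 Pu; rewrite uE w0 (lin0 (ylin _)) addr0; exact: hu1.
apply: (IH _ _ hw w0); rewrite -[w]scale1r -(mulVf a0) -scalerA; apply: subspaceZ => //.
have -> : a *: w = ys l u; last exact: Pys.
rewrite uE (linD (yslin l)) (fock_ann_notin lL hu1) ysy eqxx (fock_ann_notin lL hw).
by rewrite (lin0 (ylin _)) subr0 add0r.
Qed.

Lemma fock_findim dg L d :
  exists s : seq V, forall u, fock dg L d u -> lspan (fun v => v \in s) u.
Proof.
elim: L d => [|l L IH] d.
  exists [:: g] => u /fock_nil[[c ->] _].
  apply: subspaceZ; first exact: subspace_lspan.
  by apply: lspan_incl; rewrite inE.
have [[s hs] [s' hs']] := (IH d, IH (d - dg l)).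
exists (s ++ map (y l) s') => _ /fock_cons[u [w [/hs hu /hs' hw ->]]].
have hS := subspace_lspan (fun v => v \in s ++ map (y l) s').
apply: subspaceD => //.
  by apply: lspan_min hu => // v vs; apply: lspan_incl; rewrite mem_cat vs.
have hS' := subspace_preim (ylin l) hS.
apply: (lspan_min hS') hw => v vs; apply: lspan_incl.
by rewrite mem_cat map_f ?orbT.
Qed.

(** Each index is used at most once, so [L2] raises the degree by at most the sum of the [|dg i|],
    and [L1] never raises it. *)
Lemma fock_degree_bound dg L1 L2 d u :
  (forall i, i \in L1 -> dg i <= 0) -> \sum_(i <- L2) `|dg i| < d ->
  fock dg (L1 ++ L2) d u -> u = 0.
Proof.
elim: L1 d u => [|l L1 IH] d u hL1 hd /=.
  elim: L2 d u hd {hL1} => [|l L2 IH] d u; rewrite ?big_nil ?big_cons => hd.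
    by move=> /fock_nil[_]; apply; rewrite gt_eqF.
  move=> /fock_cons[v [w [hv hw ->]]].
  move: hd IH; set S := \sum_(_ <- _) _ => hd IH.
  by rewrite (IH _ _ _ hv) ?(IH _ _ _ hw) ?(lin0 (ylin _)) ?addr0 //; lia.
move=> /fock_cons[v [w [hv hw ->]]].
have l0 : dg l <= 0 by apply: hL1; rewrite inE eqxx.
have {}hL1 i : i \in L1 -> dg i <= 0 by move=> iL; apply: hL1; rewrite inE iL orbT.
by rewrite (IH _ _ hL1 _ hv) ?(IH _ _ hL1 _ hw) ?(lin0 (ylin _)) ?addr0 //; lia.
Qed.

(** In u = v + [y l] w with l in [L0], the cofactor w has degree d - [dg l], beyond the bound of
    [fock_degree_bound], so w = 0. *)
Lemma fock_degree_drop dg L0 L1 L2 d u :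
  (forall i, i \in L1 -> dg i <= 0) ->
  (forall i, i \in L0 -> dg i <= 0 /\ \sum_(j <- L2) `|dg j| < d - dg i) ->
  fock dg (L0 ++ L1 ++ L2) d u -> fock dg (L1 ++ L2) d u.
Proof.
elim: L0 u => [//|l L0 IH] u hL1 hL0 /= /fock_cons[v [w [hv hw ->]]].
have [l0 ld] : dg l <= 0 /\ \sum_(j <- L2) `|dg j| < d - dg l.
  by apply: hL0; rewrite inE eqxx.
have {}hL0 i : i \in L0 -> dg i <= 0 /\ \sum_(j <- L2) `|dg j| < d - dg i.
  by move=> iL; apply: hL0; rewrite inE iL orbT.
have -> : w = 0.
  apply: (@fock_degree_bound dg (L0 ++ L1) L2) ld _; last by rewrite -catA.
  by move=> i; rewrite mem_cat => /orP[/hL0[]|/hL1].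
by rewrite (lin0 (ylin _)) addr0; exact: IH.
Qed.

End Fock.

(** * Graded modules *)

Lemma big_seq_widen (T : eqType) (V : nmodType) (r t : seq T) (f : T -> V) :
  uniq r -> uniq t -> {subset r <= t} -> (forall i, i \notin r -> f i = 0) ->
  \sum_(i <- t) f i = \sum_(i <- r) f i.
Proof.
move=> ur ut rt f0; rewrite (bigID (mem r)) /= [X in _ + X]big1 => [|i /f0 //].
rewrite addr0 -big_filter; apply: perm_big; apply: uniq_perm => //.
  by rewrite filter_uniq.
by move=> i; rewrite mem_filter; case: (boolP (i \in r)) => // /rt ->.
Qed.

(** The components form a function on all integers, zero off s, so that decompositions over
    different lists can be compared pointwise. *)
Lemma direct_sum_decomp (F : numClosedFieldType) (V : lmodType F) (G : int -> V -> Prop) v :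
  direct_sum G -> exists (s : seq int) (c : int -> V),
    [/\ uniq s, forall i, G i (c i), forall i, i \notin s -> c i = 0
      & v = \sum_(i <- s) c i].
Proof.
move=> [subG spanG _].
pose P u := exists (s : seq int) (c : int -> V),
    [/\ uniq s, forall i, G i (c i), forall i, i \notin s -> c i = 0
      & u = \sum_(i <- s) c i].
have single i u : G i u -> P u.
  move=> Gu; exists [:: i], (fun j => if j == i then u else 0); split=> //.
  - by move=> j; case: eqP => [->//|_]; case: (subG j).
  - by move=> j; rewrite inE => /negbTE->.
  - by rewrite big_seq1 eqxx.
apply: (@lspan_min _ _ _ P _ _ _ (spanG v)) => [|u]; last by case=> i; exact: single.
split.
  by exists [::], (fun=> 0); split=> //; [move=> i; case: (subG i)|rewrite big_nil].
move=> b u w [s [c [us Gc c0 ->]]] [t [d [ut Gd d0 ->]]].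
exists (undup (s ++ t)), (fun i => b *: c i + d i); split.
- exact: undup_uniq.
- by move=> i; case: (subG i) => _; apply.
- move=> i; rewrite mem_undup mem_cat negb_or => /andP[/c0 -> /d0 ->].
  by rewrite scaler0 addr0.
- have sub1 : {subset s <= undup (s ++ t)} by move=> i si; rewrite mem_undup mem_cat si.
  have sub2 : {subset t <= undup (s ++ t)} by move=> i ti; rewrite mem_undup mem_cat ti orbT.
  rewrite -(big_seq_widen us (undup_uniq _) sub1 c0).
  rewrite -(big_seq_widen ut (undup_uniq _) sub2 d0).
  by rewrite big_split scaler_sumr.
Qed.

Lemma direct_sum_uniq (F : numClosedFieldType) (V : lmodType F) (G : int -> V -> Prop)
    (s t : seq int) (c d : int -> V) : direct_sum G -> uniq s -> uniq t ->
  (forall i, G i (c i)) -> (forall i, G i (d i)) ->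
  (forall i, i \notin s -> c i = 0) -> (forall i, i \notin t -> d i = 0) ->
  \sum_(i <- s) c i = \sum_(i <- t) d i -> c =1 d.
Proof.
move=> [subG _ dirG] us ut Gc Gd c0 d0 e i.
have [ist|] := boolP (i \in undup (s ++ t)); last first.
  by rewrite mem_undup mem_cat negb_or => /andP[/c0 -> /d0 ->].
apply/eqP; rewrite -subr_eq0; apply/eqP.
apply: (dirG (undup (s ++ t)) (fun i => c i - d i)) ist; first exact: undup_uniq.
  by move=> j _; apply: subspaceB.
have sub1 : {subset s <= undup (s ++ t)} by move=> j sj; rewrite mem_undup mem_cat sj.
have sub2 : {subset t <= undup (s ++ t)} by move=> j tj; rewrite mem_undup mem_cat tj orbT.
rewrite sumrB (big_seq_widen us (undup_uniq _) sub1 c0).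
by rewrite (big_seq_widen ut (undup_uniq _) sub2 d0) e subrr.
Qed.

Section Graded.
Variables (F : numClosedFieldType) (n : nat).
Implicit Types M N : gmodule F n.

Lemma gcomp0 M i : gcomp i (0 : M).
Proof. by have [/(_ i)[]] := gcomp_direct M. Qed.

Lemma gcomp_disjoint M i j (v : M) : gcomp i v -> gcomp j v -> i != j -> v = 0.
Proof.
move=> vi vj ij; have [subG _ dirG] := gcomp_direct M.
pose c k := if k == i then v else - v; have <- : c i = v by rewrite /c eqxx.
apply: (dirG [:: i; j]); rewrite /c.
- by rewrite /= inE ij.
- move=> k; rewrite !inE => /orP[/eqP->|/eqP->]; first by rewrite eqxx.
  rewrite eq_sym (negbTE ij) -scaleN1r; exact: subspaceZ.
- by rewrite !big_cons big_nil eqxx eq_sym (negbTE ij) addr0 subrr.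
- by rewrite inE eqxx.
Qed.

Lemma homogeneous_span M (P : M -> Prop) : subspace P ->
  (forall i v, gcomp i v -> P v) -> forall v, P v.
Proof.
move=> hP h v; have [_ spanG _] := gcomp_direct M.
apply: (lspan_min hP _ (spanG v)) => u; case=> i; exact: h.
Qed.

(** The components of v map to those of f v, so by uniqueness only the one in degree i survives. *)
Lemma graded_bij_reflect M N (f : M -> N) (s : int) : linear f -> injective f ->
  (forall i v, gcomp i v -> gcomp (i + s) (f v)) ->
  forall i v, gcomp (i + s) (f v) -> gcomp i v.
Proof.
move=> flin finj fG i v fv.
have [r [c [ur Gc c0 vE]]] := direct_sum_decomp v (gcomp_direct M).
have cE : (fun j => f (c (j - s))) =1 (fun j => if j == i + s then f v else 0).
  apply: (@direct_sum_uniq _ _ _ [seq j + s | j <- r] [:: i + s] _ _ (gcomp_direct N)).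
  - by rewrite map_inj_uniq // => x z /addIr.
  - by [].
  - by move=> j; rewrite -[X in gcomp X](subrK s); exact: fG.
  - by move=> j; case: eqP => [->//|_]; exact: gcomp0.
  - move=> j jr; rewrite c0 ?lin0 //; apply: contra jr => jr.
    by apply/mapP; exists (j - s); rewrite ?subrK.
  - by move=> j; rewrite inE => /negbTE->.
  - rewrite big_map big_seq1 eqxx [in RHS]vE lin_sum //.
    by apply: eq_bigr => j _; rewrite addrK.
suff -> : v = c i by [].
apply: finj; have := cE (i + s).
by rewrite eqxx addrK.
Qed.

(** The maps constructed later start at a Verma module or its quotient, while the isomorphism sought
    ends there; [graded_bij_reflect] supplies the converse half of the grading condition. *)
Lemma giso_shift_sym M N (f : M -> N) (s : int) : hmod_hom f -> bijective f ->
  (forall i v, gcomp i v -> gcomp (i + s) (f v)) -> giso_shift N M.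
Proof.
move=> [flin fact] [f' fK f'K] fG; exists f', (- s); split.
- split=> [c u v|x v]; apply: (can_inj fK); first by rewrite flin !f'K.
  by rewrite fact !f'K.
- by exists f.
move=> i v; split=> h.
  apply: (graded_bij_reflect flin (can_inj fK) fG).
  by rewrite f'K subrK.
by rewrite -[v]f'K -(subrK s i); exact: fG.
Qed.

Lemma submodule_hloop (M : hmodule F n) (P : M -> Prop) : subspace P ->
  (forall h k v, P v -> P (hact (hloop h k) v)) ->
  (forall v, P v -> P (hact hK v)) -> submodule P.
Proof.
move=> hP Ph PK; split=> // x v Pv; have [s ->] := heis_decomp x.
rewrite (linD (hact_linl v)) (lin_sum (hact_linl v)); apply: subspaceD => //.
  by apply: subspace_sum => // k _; exact: Ph.
by rewrite (linZ _ _ (hact_linl v)); apply: subspaceZ => //; exact: PK.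
Qed.

Lemma hparity_hloop (h : cartan F n) k : hparity (odd_int k) (hloop h k).
Proof. by split=> // m /=; case: (m =P k) => [->|_]; rewrite ?eqxx. Qed.

Lemma hparity_hK : hparity false (hK : heis F n).
Proof. by split=> // k; rewrite /= eqxx. Qed.

Lemma hbr_hK (x : heis F n) : hbr hK x = 0.
Proof. exact: hbr_even. Qed.

(* If z were bijective, [1 - z] would have a proper nonzero image: a homogeneous
   v = u - z u forces v to be a component of u and all z^k v to be components
   too.  This uses irreducibility of N as an ungraded module. *)
Lemma graded_central_eq0 (N : gmodule F n) (e : int) (z : N -> N) :
  irreducible N -> linear z -> (forall x v, z (hact x v) = hact x (z v)) ->
  e != 0 -> (forall i v, gcomp i v -> gcomp (i + e) (z v)) ->
  forall v, z v = 0.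
Proof.
move=> [[v0 v0N] irrN] zlin zact e0 zG.
have kerz : submodule (fun v => z v = 0).
  split; first exact: (subspace_preim zlin (@subspace_eq0 _ N)).
  by move=> x v hv; rewrite zact hv hact0r.
have [kerz0|//] := irrN _ kerz; exfalso.
have imB : submodule (fun v => exists u, v = u - z u).
  split; first split.
  - by exists 0; rewrite (lin0 zlin) subr0.
  - move=> c _ _ [u ->] [w ->]; exists (c *: u + w).
    by rewrite zlin scalerBr opprD addrACA.
  - by move=> x _ [u ->]; exists (hact x u); rewrite (linB (hact_linr x)) zact.
have iterz i k v : gcomp i v -> gcomp (i + e *+ k) (iter k z v).
  move=> vi; elim: k => [|k IH]; first by rewrite addr0.
  by rewrite mulrS addrCA addrC; exact: zG.
have iter0 k v : iter k z v = 0 -> v = 0.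
  by elim: k => //= k IH /kerz0.
apply: v0N; apply: (homogeneous_span (@subspace_eq0 _ N)) => i v vi.
have [im0|imT] := irrN _ imB.
  (* If 1 - z is zero, then z v = v lies in two different degrees. *)
  have zv : z v = v by apply/esym/eqP; rewrite -subr_eq0; apply/eqP/im0; exists v.
  apply: (gcomp_disjoint vi (j := i + e)); first by rewrite -zv; exact: zG.
  by rewrite -subr_eq0 opprD addNKr oppr_eq0.
have [u vE] := imT v.
have [r [c [ur Gc c0 uE]]] := direct_sum_decomp u (gcomp_direct N).
(* Compare both sides of v = u - z u degree by degree. *)
have cE : (fun j => c j - z (c (j - e))) =1 (fun j => if j == i then v else 0).
  pose t := undup (r ++ [seq j + e | j <- r]).
  apply: (@direct_sum_uniq _ _ _ t [:: i] _ _ (gcomp_direct N)).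
  - exact: undup_uniq.
  - by [].
  - move=> j; apply: subspaceB; first by case: (gcomp_direct N).
      exact: Gc.
    by rewrite -[X in gcomp X](subrK e); exact: zG.
  - by move=> j; case: eqP => [->//|_]; exact: gcomp0.
  - move=> j; rewrite mem_undup mem_cat negb_or => /andP[/c0 -> jr].
    rewrite c0 ?(lin0 zlin) ?subr0 //; apply: contra jr => jr.
    by apply/mapP; exists (j - e); rewrite ?subrK.
  - by move=> j; rewrite inE => /negbTE->.
  rewrite big_seq1 eqxx vE uE (lin_sum zlin) /= sumrB; congr (_ - _).
    apply: big_seq_widen => //; first exact: undup_uniq.
    by move=> j jr; rewrite mem_undup mem_cat jr.
  rewrite [LHS](@big_seq_widen _ _ [seq j + e | j <- r]).
  - by rewrite big_map; apply: eq_bigr => j _; rewrite addrK.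
  - by rewrite map_inj_uniq // => x y /addIr.
  - exact: undup_uniq.
  - by move=> j jr; rewrite mem_undup mem_cat jr orbT.
  move=> j jr; rewrite c0 ?(lin0 zlin) //; apply: contra jr => jr.
  by apply/mapP; exists (j - e); rewrite ?subrK.
have cS j : j != i -> c j = z (c (j - e)).
  by move=> /negbTE ji; have := cE j; rewrite ji => /eqP; rewrite subr_eq0 => /eqP.
have finc (d : int) : d != 0 -> exists k : nat, c (i + d *+ k.+1) = 0.
  move=> d0; pose f (k : nat) := i + d *+ k.+1.
  apply: contrapT => h.
  have finj : injective f.
    by move=> k l /addrI /(mulrIn d0) [].
  have : (size (map f (iota 0 (size r).+1)) <= size r)%N.
    apply: uniq_leq_size; first by rewrite map_inj_uniq ?iota_uniq.
    move=> _ /mapP[k _ ->]; apply: contrapT => /negP fr.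
    by apply: h; exists k; apply: c0.
  by rewrite size_map size_iota ltnn.
have ne (d : int) k : d != 0 -> i + d *+ k.+1 != i.
  by move=> d0; rewrite -subr_eq0 addrC addKr mulrn_eq0.
(* On the ray i - k e some component is zero, by finite support; c j = z (c (j - e)) carries this
   zero up to i - e. *)
have left0 : c (i - e) = 0.
  have Ne0 : - e != 0 by rewrite oppr_eq0.
  have [k] := finc _ Ne0; elim: k => [|k IH] hk; first by rewrite mulr1n in hk.
  apply: IH; have := cS _ (ne _ k Ne0); rewrite -addrA -mulrSr hk.
  by rewrite lin0.
have vc : v = c i.
  by have := cE i; rewrite eqxx left0 (lin0 zlin) subr0.
(* On the other ray the components are the z^k v, one of which is zero; injectivity of z then gives
   v = 0. *)
have right k : c (i + e *+ k) = iter k z v.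
  elim: k => [|k IH]; first by rewrite addr0 vc.
  by rewrite cS ?ne // mulrSr addrA addrK IH.
by have [k] := finc _ e0; rewrite right => /iter0.
Qed.

End Graded.

(** * Creation and annihilation operators *)

Section Positions.
Variables (n : nat) (phi : signs n).

(* The pair p = (m, j) labels the creation operator of M_phi, the multiple of
   h^j (x) t^k lying in the minus part with |k| = 2m + 1; cdeg p is this k. *)
Definition cdeg (p : nat * 'I_n.-1) : int :=
  if phi p.1 p.2 then - (2 * p.1 + 1)%N%:Z else (2 * p.1 + 1)%N%:Z.

Lemma odd_cdeg p : odd_int (cdeg p).
Proof. by rewrite /odd_int /cdeg; case: ifP => _; lia. Qed.

Lemma cdeg_neq_opp p q : p.2 = q.2 -> cdeg p != - cdeg q.
Proof.
case: p q => [m j] [k l] /= <-; rewrite /cdeg /=.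
have [->|mk] := eqVneq m k; first by case: (phi k j); lia.
by case: (phi m j); case: (phi k j); lia.
Qed.

Lemma cdeg_inj p q : p.2 = q.2 -> cdeg p = cdeg q -> p = q.
Proof.
case: p q => [m j] [k l] /= <-; rewrite /cdeg /= => h; congr (_, _).
by move: h; case: (phi m j); case: (phi k j); lia.
Qed.

Lemma odd_int_cdeg e j : odd_int e ->
  exists m, e = cdeg (m, j) \/ e = - cdeg (m, j).
Proof.
rewrite /odd_int => oe; exists (`|e|./2)%N; rewrite /cdeg /=.
have e2 : (`|e| = 2 * `|e|./2 + 1)%N by lia.
by case: (phi _ j); lia.
Qed.

End Positions.

Section TildeModule.
Variables (F : numClosedFieldType) (n : nat) (hb : 'I_n.-1 -> cartan F n).
Hypothesis hbP : orthonormal_basis hb.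
Implicit Types (h : cartan F n) (x : heis F n).

Lemma hloop_linear k : linear (fun h : cartan F n => hloop h k).
Proof.
move=> c h h'; apply: injective_projections.
  apply: val_inj; apply/funext => m /=.
  change ((if m == k then c *: h + h' else 0) =
    c *: (if m == k then h else 0) + (if m == k then h' else 0)).
  by case: eqP => // _; rewrite scaler0 addr0.
by change ((0 : F) = c * 0 + 0); rewrite mulr0 addr0.
Qed.

Lemma hdeg_decomp e x : hdeg e x -> x = hloop (x.1 e) e + x.2 *: hK.
Proof.
move=> [he _]; apply: injective_projections; last first.
  by change (x.2 = 0 + x.2 * 1); rewrite add0r mulr1.
apply: val_inj; apply/funext => m.
change (x.1 m = (if m == e then x.1 e else 0) + x.2 *: 0).
rewrite scaler0 addr0; case: eqP => [->//|/eqP me].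
by apply/eqP; apply: contraNT me => /he ->.
Qed.

Lemma heven0_hloop h k : ~~ odd_int k -> heven0 (hloop h k).
Proof.
move=> ok; split=> // m om /=; case: eqP => // mk.
by rewrite -mk om in ok.
Qed.

Variables (M : hmodule F n) (a : F).
Hypothesis tildeM : tilde_module M.
Hypothesis levelM : forall v : M, hact hK v = a *: v.

Lemma hact_xgen j k (v : M) :
  hact (xgen hb j k) v = (sqrtC 2)^-1 *: hact (hloop (hb j) k) v.
Proof. exact: linZ (hact_linl v). Qed.

Lemma sqrtC2_neq0 : sqrtC (2 : F) != 0.
Proof. by rewrite sqrtC_eq0 pnatr_eq0. Qed.

Lemma hact_hloop_basis j k (v : M) :
  hact (hloop (hb j) k) v = sqrtC 2 *: hact (xgen hb j k) v.
Proof. by rewrite hact_xgen scalerA divff ?sqrtC2_neq0 // scale1r. Qed.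

(** For odd k and m the superbracket is an anticommutator; its loop part has even degree and acts by
    0, which leaves the K part. *)
Lemma hloop_anticomm h h' k m (v : M) : odd_int k -> odd_int m ->
  hact (hloop h k) (hact (hloop h' m) v) + hact (hloop h' m) (hact (hloop h k) v) =
  (if m == - k then 2 * \tr (cmx h *m cmx h') * a else 0) *: v.
Proof.
move=> ok om; have := hact_hbr v (hparity_hloop h k) (hparity_hloop h' m).
rewrite ok om expr1 scaleN1r opprK => <-; rewrite hbr_hloop ok om /=.
rewrite (linD (hact_linl v)) tildeM; last first.
  by apply: heven0_hloop; move: ok om; rewrite /odd_int; lia.
rewrite add0r (linZ _ _ (hact_linl v)) levelM scalerA.
by case: eqP => //; rewrite mul0r.
Qed.

(** The factor 1/sqrt 2 in [xgen], squared, cancels the 2 in front of the trace. *)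
Lemma xgen_anticomm i j k m (v : M) : odd_int k -> odd_int m ->
  hact (xgen hb i k) (hact (xgen hb j m) v) + hact (xgen hb j m) (hact (xgen hb i k) v) =
  (if (i == j) && (m == - k) then a else 0) *: v.
Proof.
move=> ok om; rewrite !hact_xgen !(linZ _ _ (hact_linr _)) !scalerA -scalerDr.
rewrite hloop_anticomm // scalerA; congr (_ *: _).
have [_ ->] := hbP; case: eqP => [_|_]; last by rewrite andbF mulr0.
have [_|_] /= := eqVneq i j; last by rewrite mulr0 mul0r mulr0.
by rewrite mulr1 mulrA -invfM -expr2 sqrtCK mulVf ?mul1r // pnatr_eq0.
Qed.

Lemma xgen_sq j k (v : M) :
  odd_int k -> hact (xgen hb j k) (hact (xgen hb j k) v) = 0.
Proof.
move=> ok; have /eqP := xgen_anticomm j j v ok ok.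
have /negbTE-> : k != - k by move: ok; rewrite /odd_int; lia.
by rewrite andbF scale0r -mulr2n -scaler_nat scaler_eq0 pnatr_eq0 => /eqP.
Qed.

(** A general subspace P serves both for closure under the action and, with P the zero subspace, for
    vanishing. *)
Lemma hact_odd_span e x (P : M -> Prop) (v : M) : hdeg e x -> odd_int e ->
  subspace P -> (forall j, P (hact (xgen hb j e) v)) -> P (hact x v).
Proof.
move=> xe oe hP Pe; have [span _] := hbP; have [c xE] := span (x.1 e).
have x2 : x.2 = 0 by case: xe => _; apply; apply: contraTneq oe => ->.
rewrite (hdeg_decomp xe) x2 scale0r addr0 xE (lin_sum (hloop_linear e)).
rewrite (lin_sum (hact_linl v)); apply: subspace_sum => // j _.
rewrite (linZ _ _ (hloop_linear e)) (linZ _ _ (hact_linl v)) hact_hloop_basis.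
by do 2 apply: subspaceZ => //.
Qed.

Lemma hact_even e x (v : M) : hdeg e x -> ~~ odd_int e ->
  hact x v = (x.2 * a) *: v /\ (e != 0 -> hact x v = 0).
Proof.
move=> xe oe; have hE : hact x v = (x.2 * a) *: v.
  rewrite {1}(hdeg_decomp xe) (linD (hact_linl v)) tildeM; last exact: heven0_hloop.
  by rewrite add0r (linZ _ _ (hact_linl v)) levelM scalerA.
by split=> // e0; case: xe => _ x2; rewrite hE x2 // mul0r scale0r.
Qed.

Lemma submodule_xgen (P : M -> Prop) : subspace P ->
  (forall j e v, odd_int e -> P v -> P (hact (xgen hb j e) v)) -> submodule P.
Proof.
move=> hP Px; apply: submodule_hloop => // [h k v Pv|v Pv]; last first.
  by rewrite levelM; exact: subspaceZ.
have [ok|ok] := boolP (odd_int k).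
  by apply: (hact_odd_span (hdeg_hloop h k) ok) => // j; exact: Px.
by rewrite tildeM; [case: hP|exact: heven0_hloop].
Qed.

Variable phi : signs n.

Definition crea (p : nat * 'I_n.-1) (v : M) : M := hact (xgen hb p.2 (cdeg phi p)) v.
Definition anni (p : nat * 'I_n.-1) (v : M) : M := hact (xgen hb p.2 (- cdeg phi p)) v.

Lemma odd_opp_cdeg p : odd_int (- cdeg phi p).
Proof. by have := odd_cdeg phi p; rewrite /odd_int; lia. Qed.

Lemma crea_linear p : linear (crea p). Proof. exact: hact_linr. Qed.
Lemma anni_linear p : linear (anni p). Proof. exact: hact_linr. Qed.

Lemma crea_anti p q v : crea p (crea q v) = - crea q (crea p v).
Proof.
apply/eqP; rewrite -addr_eq0 xgen_anticomm ?odd_cdeg //.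
have [pq|_] /= := eqVneq p.2 q.2; last by rewrite scale0r.
by rewrite (negbTE (cdeg_neq_opp _ (esym pq))) scale0r.
Qed.

Lemma crea_sq p v : crea p (crea p v) = 0.
Proof. by rewrite /crea xgen_sq // odd_cdeg. Qed.

Lemma anni_crea p q v :
  anni p (crea q v) = (if p == q then a *: v else 0) - crea q (anni p v).
Proof.
apply/eqP; rewrite -subr_eq opprK xgen_anticomm ?odd_cdeg ?odd_opp_cdeg // opprK.
have [->|pq] := eqVneq p q; first by rewrite !eqxx.
have [pq2|_] /= := eqVneq p.2 q.2; last by rewrite scale0r.
have [e|_] := eqVneq (cdeg phi q) (cdeg phi p); last by rewrite scale0r.
by rewrite (cdeg_inj pq2 (esym e)) eqxx in pq.
Qed.

Lemma xgen_crea_anni j e : odd_int e -> exists m,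
  (forall v : M, hact (xgen hb j e) v = crea (m, j) v) /\ e = cdeg phi (m, j) \/
  (forall v : M, hact (xgen hb j e) v = anni (m, j) v) /\ e = - cdeg phi (m, j).
Proof. by move=> /(odd_int_cdeg phi j)[m [->|->]]; exists m; [left|right]. Qed.

Lemma hphi_anni p : hphi hb phi true (xgen hb p.2 (- cdeg phi p)).
Proof.
apply: subspaceZ; first exact: subspace_lspan.
apply: lspan_incl; exists p.1, p.2; rewrite /cdeg.
by case E: (phi p.1 p.2); [left; rewrite opprK|right].
Qed.

Lemma highest_of_anni (v : M) : (forall p, anni p v = 0) ->
  forall x, hphi hb phi true x -> hact x v = 0.
Proof.
move=> hv x; apply: (@lspan_min _ _ _ (fun x => hact x v = 0)).
  exact: (subspace_preim (hact_linl v) (@subspace_eq0 _ M)).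
move=> _ [m [i [[hphi ->]|[hphi ->]]]]; rewrite hact_hloop_basis.
- by have := hv (m, i); rewrite /anni /cdeg hphi /= opprK => ->; rewrite scaler0.
- by have := hv (m, i); rewrite /anni /cdeg hphi /= => ->; rewrite scaler0.
Qed.

End TildeModule.

(** * Verma modules *)

Section Verma.
Variables (F : numClosedFieldType) (n : nat) (hb : 'I_n.-1 -> cartan F n).
Hypothesis hbP : orthonormal_basis hb.
Variables (phi : signs n) (a : F).
Local Notation M := (phiVerma hb phi a).
Local Notation gen := (verma_gen hb phi a).

Lemma verma_ind (P : M -> Prop) : submodule P -> P gen -> forall u, P u.
Proof.
move=> [hP Pact] Pg; elim/vind; elim=> [//||t Pt u Pu|c t Pt|x t Pt].
- by rewrite vpi0; case: hP.
- by rewrite vpiD; exact: subspaceD.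
- by rewrite vpiZ; exact: subspaceZ.
- by rewrite -vactE; exact: Pact.
Qed.

Lemma verma_tilde : tilde_module M.
Proof. by case: (verma_gen_spec hb phi a). Qed.

Lemma hact_hK_hloop (W : hmodule F n) (h : cartan F n) k (v : W) :
  hact hK (hact (hloop h k) v) = hact (hloop h k) (hact hK v).
Proof.
have := hact_hbr v (@hparity_hK F n) (hparity_hloop h k).
rewrite hbr_hK (lin0 (hact_linl v)) scale1r => /esym/eqP.
by rewrite subr_eq0 => /eqP.
Qed.

Lemma verma_level (u : M) : hact hK u = a *: u.
Proof.
move: u; apply: verma_ind; last by case: (verma_gen_spec hb phi a).
apply: submodule_hloop.
- split=> [|c u v hu hv]; first by rewrite hact0r scaler0.
  by rewrite hact_linr hu hv scalerDr !scalerA mulrC.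
- by move=> h k v hv; rewrite hact_hK_hloop hv (linZ _ _ (hact_linr _)).
- by move=> v hv; rewrite hv (linZ _ _ (hact_linr _)) hv.
Qed.

Local Notation cr := (@crea F n hb M phi).
Local Notation an := (@anni F n hb M phi).

Let crL : forall p, linear (cr p) := crea_linear hb phi.
Let anL : forall p, linear (an p) := anni_linear hb phi.
Let crA := crea_anti hbP verma_tilde verma_level phi.
Let crS := crea_sq hbP verma_tilde verma_level phi.
Let anC := anni_crea hbP verma_tilde verma_level phi.

Lemma anni_gen p : an p gen = 0.
Proof.
have [_ _ hw _] := verma_gen_spec hb phi a.
by apply: hw; exact: hphi_anni.
Qed.

Local Notation vfock := (fock cr gen).

Lemma subspace_fock_ex dg d : subspace (fun u : M => exists L, vfock dg L d u).
Proof.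
split=> [|c u v [L hu] [L' hv]]; first by exists [::]; exact: fock0.
exists (L ++ L'); apply: fock_lin.
  by apply: fock_subset hu => i iL; rewrite mem_cat iL.
by apply: fock_subset hv => i iL; rewrite mem_cat iL orbT.
Qed.

Lemma fock_hact d e x (u : M) L : hdeg e x -> vfock (cdeg phi) L d u ->
  exists L', vfock (cdeg phi) L' (d + e) (hact x u).
Proof.
move=> hx hu; have [oe|oe] := boolP (odd_int e); last first.
  have [hE h0] := hact_even verma_tilde verma_level u hx oe.
  have [e0|/h0 ->] := eqVneq e 0; last by exists [::]; exact: fock0.
  by exists L; rewrite hE e0 addr0; apply: subspaceZ => //; exact: fock_sub.
have hS := subspace_fock_ex (cdeg phi) (d + e).
apply: (hact_odd_span hbP hx oe hS) => j.
have [m [[-> ->]|[-> ->]]] := xgen_crea_anni hb M phi j oe.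
  exists ((m, j) :: L); apply: (@fock_act _ _ _ _ _ _ _ d _ (m, j)) => //.
    by rewrite inE eqxx.
  by apply: fock_subset hu => i iL; rewrite inE iL orbT.
by exists L; apply: (fock_ann anL anC anni_gen).
Qed.

Lemma vcomp_fock d (u : M) : gcomp d u -> exists L, vfock (cdeg phi) L d u.
Proof.
have hS := subspace_fock_ex (cdeg phi).
move=> [t ht ->]; elim: ht => {d t u} [|d|d t u _ IHt _ IHu|d c t _ IH|d e x t hx _ [L IH]].
- by exists [::]; exact: fock_gen.
- by rewrite vpi0; exists [::]; exact: fock0.
- by rewrite vpiD; apply: (subspaceD (hS d)).
- by rewrite vpiZ; apply: (subspaceZ _ (hS d)).
- by rewrite -vactE; exact: fock_hact IH.
Qed.

(* Multiplying all degrees by 0 gives the ungraded Fock space. *)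
Local Notation dg0 := (fun p => 0 * cdeg phi p).

Lemma verma_fock (u : M) : exists L, vfock dg0 L 0 u.
Proof.
move: u; apply: homogeneous_span; first exact: subspace_fock_ex.
move=> i v /vcomp_fock[L hL]; exists L.
by have := fock_regrade 0 hL; rewrite mul0r.
Qed.

Lemma verma_simple (P : M -> Prop) (u : M) :
  a != 0 -> submodule P -> P u -> u <> 0 -> forall w, P w.
Proof.
move=> a0 hP Pu u0; apply: verma_ind => //; have [L hL] := verma_fock u.
case: hP => hP Pact.
apply: (fock_reduce crL anL crA crS anC anni_gen a0 hP _ hL u0 Pu) => p v.
exact: Pact.
Qed.

(** At level 0 all odd generators anticommute, so [cr p] passes each of them up to sign. *)
Lemma submodule_crea0 (P : M -> Prop) p : a = 0 ->
  submodule P -> submodule (fun u => P (cr p u)).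
Proof.
move=> a0 [hP Pact]; apply: (submodule_xgen hbP verma_tilde verma_level).
  exact: (subspace_preim (crL p) hP).
move=> j e v oe Pv.
have /eqP := xgen_anticomm hbP verma_tilde verma_level p.2 j v (odd_cdeg phi p) oe.
rewrite (_ : (if _ then a else 0) = 0); last by case: ifP.
rewrite scale0r addr_eq0 => /eqP h; rewrite /crea h -scaleN1r.
by apply: subspaceZ => //; exact: Pact.
Qed.

(* As in Nakayama's lemma: if a = 0 and P + y_l M = M, then {u | y_l u in P}
   contains P and y_l M, so it is everything; hence y_l M lies in P and P = M. *)
Lemma verma_local (W : hmodule F n) (f : M -> W) (P : M -> Prop) (u : M) :
  a = 0 -> hmod_hom f -> (forall x (w : W), hact x w = 0) ->
  submodule P -> P u -> f u <> 0 -> forall w, P w.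
Proof.
move=> a0 [flin fact] W0 hP Pu fu; apply: verma_ind => //.
have [L hL] := verma_fock u.
elim: L u P hL hP Pu fu => [|l L IH] u P hu hP Pu fu.
  have [[c uE] _] := fock_nil hu.
  have c0 : c != 0 by apply/eqP => c0; apply: fu; rewrite uE c0 scale0r lin0.
  by rewrite -[gen]scale1r -(mulVf c0) -scalerA -uE; apply: subspaceZ; case: hP.
have [u0 [w [hu0 _ uE]]] := fock_cons crL crA crS hu.
(* The trivial action on W makes f vanish on [cr l w], so replacing u by its part without l keeps f
   nonzero. *)
have fu0 : f u0 <> 0 by move: fu; rewrite uE (linD flin) fact W0 addr0.
have hP' := submodule_crea0 l a0 hP.
have P'u0 : P (cr l u0).
  have -> : cr l u0 = cr l u by rewrite uE (linD (crL l)) crS addr0.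
  by case: hP => _; apply.
have P'gen := IH _ _ hu0 hP' P'u0 fu0.
have P'all := verma_ind hP' P'gen.
apply: (IH _ _ hu0 hP _ fu0); have -> : u0 = u - cr l w by rewrite uE addrK.
by apply: subspaceB => //; case: hP.
Qed.

End Verma.

(** * Dimension of the graded components of Verma modules *)

Section FiniteDimension.
Variables (F : numClosedFieldType) (n : nat) (hb : 'I_n.-1 -> cartan F n).
Hypothesis hbP : orthonormal_basis hb.
Variables (phi : signs n) (a : F).
Local Notation M := (phiVerma hb phi a).
Local Notation gen := (verma_gen hb phi a).

Local Notation cr := (@crea F n hb M phi).
Local Notation an := (@anni F n hb M phi).
Local Notation vfock := (fock cr gen).
Local Notation dg0 := (fun p => 0 * cdeg phi p).

Let vt := @verma_tilde F n hb phi a.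
Let vl := @verma_level F n hb phi a.
Let crL : forall p, linear (cr p) := crea_linear hb phi.
Let anL : forall p, linear (an p) := anni_linear hb phi.
Let crA := crea_anti hbP vt vl phi.
Let crS := crea_sq hbP vt vl phi.
Let anC := anni_crea hbP vt vl phi.
Let anG := @anni_gen F n hb phi a.

Lemma fst_bound (T : Type) (L : seq (nat * T)) :
  exists B : nat, all (fun p => p.1 < B)%N L.
Proof.
elim: L => [|p L [B hB]]; first by exists 0%N.
exists (maxn p.1.+1 B) => /=; rewrite leq_max leqnn /=.
by apply: sub_all hB => q qB; rewrite leq_max qB orbT.
Qed.

(** Each vector of s involves only finitely many creation operators; joining the index lists gives
    L. *)
Lemma fin_dim_fock (G : M -> Prop) (s : seq M) :
  (forall v, G v -> lspan (fun u => u \in s) v) ->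
  exists L, forall v, G v -> vfock dg0 L 0 v.
Proof.
move=> sG; have [L hL] : exists L, forall v, v \in s -> vfock dg0 L 0 v.
  elim: s {sG} => [|u s [L hL]]; first by exists [::].
  have [L' hL'] := verma_fock hbP u; exists (L' ++ L) => v.
  rewrite inE => /orP[/eqP->|/hL hv].
    by apply: fock_subset hL' => i iL; rewrite mem_cat iL.
  by apply: fock_subset hv => i iL; rewrite mem_cat iL orbT.
exists L => v /sG; apply: lspan_min => //; exact: fock_sub.
Qed.

Definition box (C : nat) : seq (nat * 'I_n.-1) :=
  [seq (m, j) | m <- iota 0 C, j <- enum 'I_n.-1].

Lemma mem_box C p : (p \in box C) = (p.1 < C)%N.
Proof.
case: p => m j; apply/allpairsP/idP => [[[k l] /= [kC _ [-> _]]]|mC].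
  by move: kC; rewrite mem_iota.
by exists (m, j); rewrite mem_iota mem_enum.
Qed.

(* With only finitely many indices of positive degree, a monomial of given
   degree cannot involve indices of very negative degree. *)
Lemma eventually_constant_fin_dim B b :
  (forall m j, (B <= m)%N -> phi m j = b) -> fin_dim_components M.
Proof.
(* The sign e makes [dg p] negative for every index at position B or later. *)
move=> hB; move=> d; pose e : int := if b then 1 else -1.
pose dg p : int := e * cdeg phi p.
have dgB p : (B <= p.1)%N -> dg p = - (2 * p.1 + 1)%N%:Z.
  by move=> Bp; rewrite /dg /cdeg hB // /e; case: (b); lia.
pose D : int := \sum_(p <- box B) `|dg p|.
(* A near index, defined below, at position m has 2m + 1 <= [D] - e d, hence m < [C]. *)
pose C := (B + `|D| + `|d|)%N.+1.
have [s hs] := fock_findim gen crL crA crS dg (box C) (e * d).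
exists s => v /(vcomp_fock hbP)[L /(fock_regrade e) hL]; apply: hs.
(* A far index would need a cofactor of degree above [D], the most that [box B] can supply;
   [fock_degree_drop] removes it. *)
pose far p := (B <= p.1)%N && (D < e * d - dg p).
pose near p := (B <= p.1)%N && ~~ (D < e * d - dg p).
suff : vfock dg ([seq p <- L | near p] ++ box B) (e * d) v.
  apply: fock_subset => -[m j]; rewrite mem_cat mem_filter !mem_box /C /=.
  move=> /orP[/andP[/andP[/= Bm] + _]|]; last by lia.
  by rewrite dgB // -leNgt /= /e; case: (b); rewrite ?mul1r ?mulN1r; lia.
apply: (fock_degree_drop crL crA crS (L0 := [seq p <- L | far p])).
- by move=> p; rewrite mem_filter => /andP[/andP[Bp _] _]; rewrite dgB //; lia.
- by move=> p; rewrite mem_filter => /andP[/andP[Bp pD] _]; split=> //; rewrite dgB //; lia.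
apply: fock_subset hL => p pL; rewrite !mem_cat !mem_filter pL mem_box /near /far.
by case: (D < _); rewrite ?andbT ?andbF ?orbF ?orFb; case: leqP => //=.
Qed.

Hypothesis a0 : a != 0.
Hypothesis gen0 : gen <> 0.

(** [an p] kills everything built without p, yet sends this vector to a times [cr q gen]; [an q]
    then yields a times [gen], which is nonzero. *)
Lemma crea2_notin_fock L p q : p != q -> p \notin L ->
  ~ vfock dg0 L 0 (cr p (cr q gen)).
Proof.
move=> pq pL h; apply: gen0.
have aZ (v : M) : a *: v = 0 -> v = 0.
  by move=> /eqP; rewrite scaler_eq0 (negbTE a0) => /eqP.
have := fock_ann_notin crL anL anC anG pL h.
rewrite anC eqxx [an p _]anC (negbTE pq) anG (lin0 (crL q)) subr0 (lin0 (crL p)) subr0.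
move=> /aZ h1; have := anC q q gen.
by rewrite h1 (lin0 (anL q)) eqxx anG (lin0 (crL q)) subr0 => /esym/aZ.
Qed.

Lemma gcomp_crea2 p q : gcomp (cdeg phi q + cdeg phi p) (cr p (cr q gen)).
Proof.
have hx r : hdeg (cdeg phi r) (xgen hb r.2 (cdeg phi r)).
  have [h1 h2] := hdeg_hloop (hb r.2) (cdeg phi r).
  split=> [k|r0]; last by change ((sqrtC 2)^-1 * (0 : F) = 0); rewrite mulr0.
  move=> kr; apply: h1; apply: contraNneq kr => kr.
  by change ((sqrtC 2)^-1 *: (hloop (hb r.2) (cdeg phi r)).1 k == 0); rewrite kr scaler0.
apply: (gcomp_act (hx p)); rewrite -[cdeg phi q]add0r; apply: (gcomp_act (hx q)).
by case: (verma_gen_spec hb phi a).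
Qed.

(* Two creation operators at consecutive positions and of opposite signs give a
   vector of degree 0 or +-2; infinitely many sign changes would make one of
   these three components infinite-dimensional. *)
Lemma fin_dim_eventually_constant (j0 : 'I_n.-1) : fin_dim_components M ->
  exists B b, forall m j, (B <= m)%N -> phi m j = b.
Proof.
move=> fd; have fL d : exists L, forall v : M, gcomp d v -> vfock dg0 L 0 v.
  by have [s hs] := fd d; exact: fin_dim_fock hs.
have [[L0 h0] [[L1 h1] [L2 h2]]] := conj (fL 0) (conj (fL 2) (fL (-2))).
have [B /allP hB] := fst_bound (L0 ++ L1 ++ L2); exists B, (phi B j0).
have notL p : (B <= p.1)%N -> p \notin L0 ++ L1 ++ L2.
  by move=> Bp; apply/negP => /hB; rewrite ltnNge Bp.
have opp p q : (B <= p.1)%N -> p != q ->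
    cdeg phi q + cdeg phi p \in [:: 0; 2; -2] -> False.
  move=> Bp pq; have := notL p Bp; rewrite !mem_cat !negb_or => /and3P[n0 n1 n2].
  have := gcomp_crea2 p q; rewrite !inE => h /or3P[] /eqP e; rewrite e in h.
  - exact: crea2_notin_fock pq n0 (h0 _ h).
  - exact: crea2_notin_fock pq n1 (h1 _ h).
  - exact: crea2_notin_fock pq n2 (h2 _ h).
(* Opposite signs at one position give total degree 0; at positions m and m + 1 they give 2 or
   -2. *)
have same m i j : (B <= m)%N -> phi m i = phi m j.
  move=> Bm; apply: contrapT => ne; apply: (opp (m, i) (m, j) Bm).
    by apply/eqP => -[ij]; rewrite ij in ne.
  by move: ne; rewrite /cdeg /= !inE; case: (phi m i); case: (phi m j) => // _; lia.
have next m i : (B <= m)%N -> phi m.+1 i = phi m i.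
  move=> Bm; apply: contrapT => ne; apply: (opp (m, i) (m.+1, i) Bm).
    by apply/eqP => -[]; lia.
  by move: ne; rewrite /cdeg /= !inE; case: (phi m i); case: (phi m.+1 i) => // _; lia.
move=> m j Bm; rewrite (same m j j0 Bm) -(subnKC Bm).
elim: (m - B)%N => [|k IH]; first by rewrite addn0.
by rewrite addnS next ?leq_addr.
Qed.

End FiniteDimension.

(** The index j has a finite range, so a set of places is finite exactly when its positions m are
    bounded. *)
Lemma finitely_differ_eventually n (phi psi : signs n) b :
  (forall m j, psi m j = b) ->
  (finitely_differ phi psi <-> exists B, forall m j, (B <= m)%N -> phi m j = b).
Proof.
move=> hpsi; split=> [/finite_seqP[s hs]|[B hB]].
  have [B /allP hB] := fst_bound s; exists B => m j Bm.
  apply: contrapT => ne; have : ([set` s])%classic (m, j).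
    by rewrite -hs /= hpsi; exact/eqP.
  by move=> /= /hB /=; rewrite ltnNge Bm.
apply: (@sub_finite_set _ _ [set` box n B]%classic); last exact: finite_seq.
move=> [m j] /= ne; rewrite mem_box /= ltnNge; apply: contra ne => Bm.
by rewrite hpsi hB.
Qed.

(** * Irreducible modules *)

Section IrreducibleModule.
Variables (F : numClosedFieldType) (n : nat) (hb : 'I_n.-1 -> cartan F n).
Hypothesis hbP : orthonormal_basis hb.
Variables (N : gmodule F n) (a : F).
Hypothesis irrN : irreducible N.
Hypothesis levelN : forall v : N, hact hK v = a *: v.

Lemma irreducible_tilde :
  (forall (h : cartan F n) (v : N), hact (hloop h 0) v = 0) -> tilde_module N.
Proof.
move=> N0 x v [xodd x2]; have [s ->] := heis_decomp x.
rewrite x2 scale0r addr0 (lin_sum (hact_linl v)) big1 // => k _.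
have [ok|ok] := boolP (odd_int k).
  by rewrite xodd // (lin0 (hloop_linear k)) (lin0 (hact_linl v)).
(* The argument by central operators needs a nonzero degree; degree 0 is the hypothesis that the
   Cartan part acts by zero. *)
have [->|k0] := eqVneq k 0; first exact: N0.
apply: (graded_central_eq0 irrN (hact_linr (hloop (x.1 k) k)) _ k0); last first.
  by move=> i w; apply: gcomp_act; exact: hdeg_hloop.
move=> y w; have hk : hbr (hloop (x.1 k) k) y = 0.
  by apply: heven0_central; exact: heven0_hloop.
have [t ->] := heis_decomp y; rewrite !(linD (hact_linl _)) (linD (hact_linr _)).
rewrite !(lin_sum (hact_linl _)) (lin_sum (hact_linr _)); congr (_ + _).
  apply: eq_bigr => m _.
  have := hact_hbr w (hparity_hloop (x.1 k) k) (hparity_hloop (y.1 m) m).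
  rewrite heven0_central; last exact: heven0_hloop.
  rewrite (negbTE ok) (lin0 (hact_linl w)) scale1r => /esym/eqP.
  by rewrite subr_eq0 => /eqP.
by rewrite !(linZ _ _ (hact_linl _)) (linZ _ _ (hact_linr _)) hact_hK_hloop.
Qed.

Hypothesis tildeN : tilde_module N.

(* At level 0 the image of an odd generator is a submodule, on which the
   generator acts by zero, so it cannot be everything. *)
Lemma level0_act0 : a = 0 -> forall x (v : N), hact x v = 0.
Proof.
move=> a0; have [[v0 v0N] irr] := irrN.
have x0 j e (v : N) : odd_int e -> hact (xgen hb j e) v = 0.
  move=> oe; have hP : submodule (fun w : N => exists u, w = hact (xgen hb j e) u).
    apply: (submodule_xgen hbP tildeN levelN) => [|i k _ ok [u ->]].
      split=> [|c _ _ [u ->] [w ->]]; first by exists 0; rewrite hact0r.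
      by exists (c *: u + w); rewrite hact_linr.
    exists (- hact (xgen hb i k) u); rewrite (linN (hact_linr _)).
    apply/eqP; rewrite -addr_eq0 (xgen_anticomm hbP tildeN levelN) //.
    by rewrite a0 if_same scale0r.
  have [h|h] := irr _ hP; first by apply: h; exists v.
  by have [u ->] := h v; rewrite (xgen_sq hbP tildeN levelN).
have subT : submodule (fun w : N => forall x, hact x w = 0).
  split=> [|x v hv y]; last by rewrite hv hact0r.
  split=> [x|c u w hu hw x]; first exact: hact0r.
  by rewrite hact_linr hu hw scaler0 addr0.
move=> x v; have [s ->] := heis_decomp x.
rewrite (linD (hact_linl v)) (linZ _ _ (hact_linl v)) levelN a0 scale0r scaler0 addr0.
rewrite (lin_sum (hact_linl v)) big1 // => k _.
have [ok|ok] := boolP (odd_int k); last by rewrite tildeN //; exact: heven0_hloop.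
apply: (hact_odd_span hbP (hdeg_hloop (x.1 k) k) ok (@subspace_eq0 _ N)) => j.
exact: x0.
Qed.

Lemma level0_trivial : a = 0 -> trivial_1dim N.
Proof.
move=> a0; have N0 := level0_act0 a0; split=> //.
have [[v v0] irr] := irrN; exists v; split=> //.
(* Under a zero action every line is a submodule. *)
have [|h|//] := irr (fun w => exists c, w = c *: v).
  split; last by move=> x w _; rewrite N0; exists 0; rewrite scale0r.
  split=> [|c _ _ [b ->] [b' ->]]; first by exists 0; rewrite scale0r.
  by exists (c * b + b'); rewrite scalerDl scalerA.
by case: v0; apply: h; exists 1; rewrite scale1r.
Qed.

(** If x_(-k) x_k v = 0, applying x_k gives a x_k v = 0. If the eigenvalue is nonzero, v lies in the
    image of x_(-k), which squares to zero. *)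
Lemma eigenvector_highest (mu : 'I_n.-1 -> nat -> F) (v : N) : a != 0 ->
  has_eigenvalues hb mu v ->
  forall x, hphi hb (phi_of mu) true x -> hact x v = 0.
Proof.
move=> a0 hmu; apply: highest_of_anni => -[r j].
have := hmu j r; rewrite /dop /anni /cdeg /phi_of /=.
set k := (2 * r + 1)%N%:Z; have ok : odd_int k by rewrite /odd_int /k; lia.
have oNk : odd_int (- k) by move: ok; rewrite /odd_int; lia.
have [->|mu0] := eqVneq (mu j r) 0; rewrite ?opprK => hd.
  have := xgen_anticomm hbP tildeN levelN j j (hact (xgen hb j k) v) ok oNk.
  rewrite hd scale0r hact0r (xgen_sq hbP tildeN levelN) // hact0r addr0 !eqxx.
  by move=> /esym/eqP; rewrite scaler_eq0 (negbTE a0) => /eqP.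
rewrite -[v]scale1r -(mulVf mu0) -scalerA -hd (linZ _ _ (hact_linr _)).
by rewrite (xgen_sq hbP tildeN levelN) // scaler0.
Qed.

(** * Irreducible modules as quotients of Verma modules *)

Variables (phi : signs n) (i0 : int) (v : N).
Hypothesis v0 : v <> 0.
Hypothesis v_deg : gcomp i0 v.
Hypothesis v_highest : forall x, hphi hb phi true x -> hact x v = 0.
Local Notation M := (phiVerma hb phi a).
Local Notation gen := (verma_gen hb phi a).

Lemma verma_surjection : exists f : M -> N,
  [/\ hmod_hom f, f gen = v, forall w, exists u, f u = w
    & forall i u, gcomp i u -> gcomp (i + i0) (f u)].
Proof.
have [f [[flin fact] fg] _] := phiVerma_universal tildeN (levelN v) v_highest.
exists f; split=> //.
  have imS : submodule (fun w => exists u, f u = w).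
    split=> [|x _ [u <-]]; last by exists (hact x u).
    split=> [|c _ _ [u <-] [w <-]]; first by exists 0; exact: lin0.
    by exists (c *: u + w); rewrite flin.
  have [_ irr] := irrN; have [h|//] := irr _ imS.
  by case: v0; apply: h; exists gen.
move=> i _ [t ht ->]; elim: ht => {i t}.
- by rewrite add0r fg.
- by move=> i; rewrite vpi0 (lin0 flin); exact: gcomp0.
- move=> i t u _ IHt _ IHu; rewrite vpiD (linD flin).
  by apply: subspaceD => //; case: (gcomp_direct N).
- move=> i c t _ IH; rewrite vpiZ (linZ _ _ flin).
  by apply: subspaceZ => //; case: (gcomp_direct N).
- move=> i d x t hx _ IH; rewrite -vactE fact addrAC.
  exact: gcomp_act.
Qed.

(** The presentation by terms does not show that the generator survives the relations; its image v
    in N does. *)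
Lemma verma_gen_neq0 : gen <> 0.
Proof.
have [f [[flin _] fg _ _]] := verma_surjection.
by move=> g0; apply: v0; rewrite -fg g0 lin0.
Qed.

Lemma surj_bijective (A B : Type) (f : A -> B) :
  injective f -> (forall w, exists u, f u = w) -> bijective f.
Proof.
move=> finj /choice[f' f'K]; exists f' => // u.
by apply: finj; rewrite f'K.
Qed.

Lemma giso_phiVerma : a != 0 -> giso_shift N M.
Proof.
move=> a0; have [f [[flin fact] fg fsurj fG]] := verma_surjection.
apply: (giso_shift_sym (f := f) (s := i0)) => //.
apply: surj_bijective => // u w e; apply: contrapT => uw; apply: v0; rewrite -fg.
have kerf : submodule (fun u => f u = 0).
  split; first exact: (subspace_preim flin (@subspace_eq0 _ N)).
  by move=> x z hz; rewrite fact hz hact0r.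
apply: (verma_simple hbP (u := u - w) a0 kerf).
  by rewrite linB // e subrr.
by move=> /eqP; rewrite subr_eq0 => /eqP.
Qed.

Lemma giso_phiIrr : giso_shift N (phiIrr hb phi a).
Proof.
have [f [[flin fact] fg fsurj fG]] := verma_surjection.
have kerf : submodule (fun u => f u = 0).
  split; first exact: (subspace_preim flin (@subspace_eq0 _ N)).
  by move=> x z hz; rewrite fact hz hact0r.
(* The kernel of f is proper, and a submodule not inside it is everything: by [verma_local] if a =
   0, by [verma_simple] otherwise. *)
have radE u : radical (u : M) <-> f u = 0.
  split=> [|fu]; last first.
    apply: lspan_incl; exists (fun u => f u = 0); split=> //.
    by move=> /(_ gen); rewrite fg.
  apply: (@lspan_min _ _ _ (fun u => f u = 0)); first by case: kerf.
  move=> w [P [hP NP Pw]]; apply: contrapT => fw; apply: NP.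
  have [a0|a0] := eqVneq a 0.
    exact: (verma_local hbP a0 (conj flin fact) (level0_act0 a0) hP Pw fw).
  by apply: (verma_simple hbP a0 hP Pw) => w0; apply: fw; rewrite w0 lin0.
pose h (q : phiIrr hb phi a) : N := f (qrepr q).
have hE u : h (qpi (radical_submodule M) u) = f u.
  apply/eqP; rewrite -subr_eq0 /h -(linB flin); apply/eqP/radE.
  exact: (qreprP (radical_submodule M)).
apply: (giso_shift_sym (f := h) (s := i0)).
- split=> [c|x]; elim/(qind (subP := radical_submodule M)) => u.
    elim/(qind (subP := radical_submodule M)) => w.
    by rewrite -qpi_linear !hE flin.
  by rewrite /= qactE !hE fact.
- apply: surj_bijective => [|w]; last first.
    by have [u <-] := fsurj w; exists (qpi (radical_submodule M) u).
  elim/(qind (subP := radical_submodule M)) => u.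
  elim/(qind (subP := radical_submodule M)) => w; rewrite !hE => e.
  by apply/qpiP/radE; rewrite linB // e subrr.
- by move=> i _ [u ui ->]; rewrite hE; exact: fG.
Qed.

End IrreducibleModule.

Theorem theorem3p9 (R : realType) (n : nat) (hb : 'I_n.-1 -> cartan R[i] n)
    (N : gmodule R[i] n) (a : R[i]) :
  (3 <= n)%N ->
  orthonormal_basis hb ->
  irreducible N ->
  diagonal hb N ->
  (forall (h : cartan R[i] n) (v : N), hact (hloop h 0) v = 0) ->
  (forall v : N, hact hK v = a *: v) ->
  [/\ tilde_module N /\ irreducible N,
      forall (i : int) (v : N) (mu : 'I_n.-1 -> nat -> R[i]),
        v <> 0 -> gcomp i v -> has_eigenvalues hb mu v ->
        [/\ highest_vector hb (phi_of mu) v,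
            giso_shift N (phiIrr hb (phi_of mu) a)
          & a <> 0 -> giso_shift N (phiVerma hb (phi_of mu) a)],
      a = 0 -> trivial_1dim N
    & a <> 0 ->
      forall mu : 'I_n.-1 -> nat -> R[i], component_tuple hb N mu ->
        (fin_dim_components (phiVerma hb (phi_of mu) a) <->
         exists nu : 'I_n.-1 -> nat -> R[i],
           constant_tuple a nu /\ finitely_differ (phi_of mu) (phi_of nu))].
Proof.
move=> n3 hbP irrN _ N0 levelN; have tildeN := irreducible_tilde irrN N0.
have highest (v : N) mu : has_eigenvalues hb mu v ->
    forall x, hphi hb (phi_of mu) true x -> hact x v = 0.
  (* At level 0 the whole algebra acts by zero, so any sign map will do. *)
  move=> hmu x hx; have [a0|a0] := eqVneq a 0.
    exact: (level0_act0 hbP irrN levelN tildeN a0).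
  exact: (eigenvector_highest hbP levelN tildeN a0 hmu).
split=> //.
- move=> i v mu v0 vi /highest hv; split=> //.
    exact: (giso_phiIrr hbP irrN levelN tildeN v0 vi hv).
  by move=> /eqP a0; exact: (giso_phiVerma hbP irrN levelN tildeN v0 vi hv a0).
- exact: (level0_trivial hbP irrN levelN tildeN).
move=> /eqP a0 mu [i [v [v0 vi /highest hv]]].
have gen0 := verma_gen_neq0 irrN levelN tildeN v0 vi hv.
(* Since n >= 3 there is an index j, whose sign at position B becomes the eventual sign. *)
have j0 : 'I_n.-1 by exists 0%N; lia.
split=> [/(fin_dim_eventually_constant hbP a0 gen0 j0)[B [b hB]]|].
  (* This constant tuple has sign b everywhere, because a is nonzero. *)
  exists (fun _ _ => if b then 0 else a); split.
    split; first by move=> j k; case: b {hB}; [left|right].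
    by case: b {hB}; [left|right => j k; exact/eqP].
  apply/(@finitely_differ_eventually _ _ _ b); last by exists B.
  by move=> m j; rewrite /phi_of; case: b {hB}; rewrite ?eqxx // (negbTE a0).
move=> [nu [[_ nuC] fd]].
have [b hb'] : exists b, forall m j, phi_of nu m j = b.
  case: nuC => h; [exists true|exists false] => m j; rewrite /phi_of.
    by rewrite h eqxx.
  exact/eqP.
have /(finitely_differ_eventually _ hb')[B hB] := fd.
exact: (eventually_constant_fin_dim hbP a hB).
Qed.
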